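(* Let $r\geq 3$ and $0<c<\frac{1}{2}$. Then for $n$ sufficiently large, \[ ex_r(n;\mathcal{L}_{n,cn}^{(r)})=\binom{n}{r}-\binom{n-\frac{cn}{r}}{r}+o(n^r). \]
   Context: An $r$-graph is a hypergraph all of whose edges have exactly $r$ vertices. A tight path is an $r$-graph whose vertices can be ordered $v_1,\dots,v_m$ so that its edges are exactly $\{v_i,\dots,v_{i+r-1}\}$ for $i=1,\dots,m-r+1$. A tight linear forest is an $r$-graph each of whose connected components is a tight path or an isolated vertex. $\mathcal{L}_{n,k}^{(r)}$ is the family of all tight linear forests on $n$ vertices with $k$ edges. $ex_r(n;\mathcal{F})$ is the maximum number of edges in an $r$-graph on $n$ vertices containing no subgraph isomorphic to a member of $\mathcal{F}$. Quantities such as $cn$ and $cn/r$ are treated as integers (rounded); $o(n^r)$ is as $n\to\infty$ with $r,c$ fixed. *)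

(* Defs.v *)
From HB Require Import structures.
From mathcomp Require Import all_boot all_order all_algebra.
From mathcomp Require Import boolp.

Set Implicit Arguments.
Unset Strict Implicit.
Unset Printing Implicit Defensive.

(* A hypergraph with vertex type T : finType is given by its edge set
   E : {set {set T}}; isolated vertices are vertices lying in no edge. *)

Definition is_rgraph (r : nat) (T : finType) (E : {set {set T}}) : Prop :=
  forall e, e \in E -> #|e| = r.

(* (V, E) is a tight path: V = {v_0, ..., v_(m-1)} and the edges are the
   m - r + 1 windows of r consecutive vertices (none if m < r). *)
Definition is_tight_path (r : nat) (T : finType)
    (V : {set T}) (E : {set {set T}}) : Prop :=
  exists s : seq T,
    [/\ uniq s, V = [set x in s] &
        E = [set [set x in take r (drop i s)] | i : 'I_((size s).+1 - r)]].

Definition is_isolated_vertex (T : finType)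
    (V : {set T}) (E : {set {set T}}) : Prop :=
  #|V| = 1 /\ E = set0.

Definition adjacent (T : finType) (E : {set {set T}}) : rel T :=
  fun x y => [exists e in E, (x \in e) && (y \in e)].

Definition component (T : finType) (E : {set {set T}}) (x : T) : {set T} :=
  [set y | connect (adjacent E) x y].

Definition induced_edges (T : finType) (E : {set {set T}}) (V : {set T}) :
    {set {set T}} :=
  [set e in E | e \subset V].

Definition is_tight_linear_forest (r : nat) (T : finType)
    (E : {set {set T}}) : Prop :=
  is_rgraph r E /\
  forall x : T,
    let V := component E x in
    is_tight_path r V (induced_edges E V) \/
    is_isolated_vertex V (induced_edges E V).

Definition hfamily := forall T : finType, {set {set T}} -> Prop.

Definition tight_linear_forests (r n k : nat) : hfamily :=
  fun T E => [/\ is_tight_linear_forest r E, #|T| = n & #|E| = k].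

(* H contains a subgraph isomorphic to F. *)
Definition contains_copy (T U : finType)
    (H : {set {set T}}) (F : {set {set U}}) : Prop :=
  exists f : U -> T,
    injective f /\ [set f @: (e : {set U}) | e in F] \subset H.

Definition family_free (FF : hfamily) (T : finType) (H : {set {set T}}) : Prop :=
  forall (U : finType) (F : {set {set U}}), FF U F -> ~ contains_copy H F.

(* The maximum over the empty set is 0; this only happens when FF contains an
   edgeless hypergraph on at most n vertices. *)
Definition turan_number (r n : nat) (FF : hfamily) : nat :=
  \max_(H : {set {set 'I_n}} | `[< is_rgraph r H /\ family_free FF H >]) #|H|.

(* Main.v *)
(* Lower bound: a vertex of a tight linear forest lies in at most r edges, so the r-sets
   meeting a fixed set of cn/r - 1 vertices contain no tight linear forest with cn edges.

   Upper bound.  If w >= 0 is a weight function on the n vertices with total weight less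
   than q <= n / (2r), then at least C(n - q, r) of the r-sets have weight less than 1: this
   is a fractional form of Frankl's bound for the Erdos matching conjecture, and it is where
   c < 1/2 is used.  So if H has eps n^r more edges than claimed, then every weight
   function w of total weight about cn/r leaves many edges of H with weight less than 1.  A density
   increment turns these light edges into an r-tuple of vertex sets of linear size, light for
   w on average, in which every choice of not too small subsets spans a long tight path.
   Frank-Wolfe iteration, with the current overload as the weight w, combines a bounded number
   of such tuples into a fractional packing of total size about cn.  Rounding it on the atoms
   of the tuples and tiling the rounded tuples by tight paths gives a tight linear forest
   with cn edges. *)
Require Import Defs.
From HB Require Import structures.
From mathcomp Require Import all_boot all_order all_algebra.
From mathcomp Require Import boolp.
From mathcomp Require Import zify ring lra.

Set Implicit Arguments.
Unset Strict Implicit.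
Unset Printing Implicit Defensive.

Import Order.TTheory GRing.Theory Num.Theory.

(** * Tight path packings and tight linear forests *)

Section Windows.
Context {T : finType}.
Implicit Types (s : seq T) (ss : seq (seq T)) (e : {set T}) (H : {set {set T}}).

Definition windows (r : nat) s : seq {set T} :=
  [seq [set x in take r (drop i s)] | i <- iota 0 ((size s).+1 - r)].

Definition tight_packing (r : nat) H ss : Prop :=
  uniq (flatten ss) /\ forall s, s \in ss -> {subset windows r s <= H}.

Lemma mem_take_drop r i s x : uniq s ->
  (x \in take r (drop i s)) = (x \in s) && (i <= index x s < i + r).
Proof.
move=> us; have [xs|xs] := boolP (x \in s); last first.
  by apply/negP => /mem_take/mem_drop; rewrite (negbTE xs).
have [si|si] := ltnP (size s) i.
  rewrite drop_oversize ?(ltnW si) // in_nil.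
  by rewrite [i <= _]leqNgt (leq_ltn_trans (index_size x s) si).
have ix : index x s = if x \in take i s then index x (take i s) else i + index x (drop i s).
  by rewrite -{1}(cat_take_drop i s) index_cat size_take_min (minn_idPl si).
have := us; rewrite -{1}(cat_take_drop i s) cat_uniq => /and3P[_ /hasPn hd _].
have := xs; rewrite -{1}(cat_take_drop i s) mem_cat.
case: ifP ix => [xt ix _|_ ix /= xd].
  have xi : index x (take i s) < i.
    by rewrite (leq_trans _ (geq_minl i (size s))) // -size_take_min index_mem.
  rewrite ix leqNgt xi /=; apply/negbTE/negP => /mem_take xd.
  by have := hd _ xd; rewrite /= xt.
by rewrite in_take // ix leq_addr ltn_add2l.
Qed.

Lemma windowsP r s e : reflect
  (exists2 i, i + r <= size s & e = [set x in take r (drop i s)]) (e \in windows r s).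
Proof.
apply: (iffP mapP) => -[i h ->]; exists i => //.
  by move: h; rewrite mem_iota; lia.
by rewrite mem_iota; lia.
Qed.

Lemma card_window r s e : uniq s -> e \in windows r s -> #|e| = r.
Proof.
move=> us /windowsP[i h ->]; rewrite cardsE.
have /card_uniqP -> : uniq (take r (drop i s)) by rewrite take_uniq // drop_uniq.
by rewrite size_take size_drop; case: ltngtP; lia.
Qed.

Lemma window_subset r s e : e \in windows r s -> {subset e <= s}.
Proof. by move=> /windowsP[i _ ->] x; rewrite inE => /mem_take/mem_drop. Qed.

Lemma windows_uniq r s : 0 < r -> uniq s -> uniq (windows r s).
Proof.
move=> r0 us; rewrite map_inj_in_uniq ?iota_uniq // => i j.
rewrite !mem_iota !add0n => hi hj E.
case: s us hi hj E => [|x0 s0]; first by rewrite /=; lia.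
set s := x0 :: s0 => us hi hj E.
have half a b : a < (size s).+1 - r -> b < (size s).+1 - r ->
    [set x in take r (drop a s)] = [set x in take r (drop b s)] -> b <= a.
  move=> ha hb /setP/(_ (nth x0 s a)); have as_ : a < size s by lia.
  rewrite !inE !mem_take_drop // mem_nth // index_uniq //= leqnn /=.
  have -> : a < a + r by lia.
  by move=> /esym/andP[].
by apply/eqP; rewrite eqn_leq; apply/andP; split; apply: half => //; apply: esym.
Qed.

Lemma size_windows r s : size (windows r s) = (size s).+1 - r.
Proof. by rewrite size_map size_iota. Qed.

Lemma windows_take r s m : {subset windows r (take m s) <= windows r s}.
Proof.
move=> e /windowsP[i h ->]; apply/windowsP; exists i.
  by apply: leq_trans h _; rewrite size_take_min geq_minr.
by rewrite !take_drop take_takel // addnC (leq_trans h) // size_take_min geq_minl.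
Qed.

Lemma trim_packing r H ss k : 0 < r -> tight_packing r H ss ->
  k <= \sum_(s <- ss) ((size s).+1 - r) ->
  exists ss', tight_packing r H ss' /\ \sum_(s <- ss') ((size s).+1 - r) = k.
Proof.
move=> r0; suff : forall ss k, tight_packing r H ss -> k <= \sum_(s <- ss) ((size s).+1 - r) ->
  exists ss', [/\ tight_packing r H ss', {subset flatten ss' <= flatten ss} &
              \sum_(s <- ss') ((size s).+1 - r) = k].
  by move=> h pss hk; have [ss' [h1 _ h2]] := h _ _ pss hk; exists ss'.
elim=> [|s {}ss IH] {}k [us ws] hk.
  by exists [::]; split=> //; move: hk; rewrite !big_nil leqn0 => /eqP.
have [ks|ks] := leqP k ((size s).+1 - r).
  exists [:: take (r.-1 + k) s]; split.
  - split; first by move: us; rewrite /= cats0 cat_uniq => /andP[us _]; apply: take_uniq.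
    move=> t; rewrite inE => /eqP -> e /windows_take es; apply: (ws s) => //.
    by rewrite mem_head.
  - by move=> x; rewrite /= cats0 mem_cat => /mem_take ->.
  - by rewrite big_seq1 size_take_min; lia.
move: us; rewrite /= cat_uniq => /and3P[us /hasPn dis uss].
have [|//|ss' [[us' ws'] sub sum]] := IH (k - ((size s).+1 - r)).
- by split => // t ht; apply: ws; rewrite inE ht orbT.
- by move: hk; rewrite big_cons; lia.
exists (s :: ss'); split.
- split.
    rewrite /= cat_uniq us us' andbT /=; apply/hasPn => x /sub; exact: dis.
  move=> t; rewrite inE => /orP[/eqP ->|]; last exact: ws'.
  by apply: ws; rewrite mem_head.
- move=> x; rewrite /= !mem_cat => /orP[->//|/sub ->]; by rewrite orbT.
- by rewrite big_cons sum; lia.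
Qed.

Lemma uniq_flatten_mem ss s : uniq (flatten ss) -> s \in ss -> uniq s.
Proof.
elim: ss => //= t ss IH; rewrite cat_uniq inE => /and3P[ut _ uss] /orP[/eqP ->//|]; exact: IH.
Qed.

Lemma uniq_flatten_inj ss s t x :
  uniq (flatten ss) -> s \in ss -> t \in ss -> x \in s -> x \in t -> s = t.
Proof.
elim: ss => //= u ss IH; rewrite cat_uniq => /and3P[_ /hasPn dis uss].
have dis' v : v \in ss -> x \in v -> x \in u -> False.
  by move=> vs xv xu; have /dis/negP := (introT flattenP (ex_intro2 _ _ v vs xv)).
rewrite !inE => /orP[/eqP->|hs] /orP[/eqP ->|ht] xs xt //.
- by case: (dis' t).
- by case: (dis' s).
- exact: IH.
Qed.

Lemma uniq_flatten_windows r ss : 0 < r -> uniq (flatten ss) ->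
  uniq (flatten [seq windows r s | s <- ss]).
Proof.
move=> r0; elim: ss => //= s ss IH; rewrite !cat_uniq => /and3P[us /hasPn dis uss].
rewrite IH // windows_uniq // andbT /=; apply/hasPn => e /flattenP[_ /mapP[t ts ->] et].
apply/negP => /= es.
have /card_gt0P[x xe] : 0 < #|e| by rewrite (card_window us es).
have xt := window_subset et xe; have xs := window_subset es xe.
have : x \in flatten ss by apply/flattenP; exists t.
by move/dis/negP; apply.
Qed.

Section PackingForest.
Variables (r : nat) (ss : seq (seq T)).
Hypotheses (r1 : 1 < r) (uss : uniq (flatten ss)).
Let F : {set {set T}} := [set e in flatten [seq windows r s | s <- ss]].

Let FP e : reflect (exists2 s, s \in ss & e \in windows r s) (e \in F).
Proof.
rewrite inE; apply: (iffP flattenP).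
  by move=> [_ /mapP[s hs ->] he]; exists s.
by move=> [s hs he]; exists (windows r s) => //; apply: map_f.
Qed.

Lemma component_packing s x : s \in ss -> r <= size s -> x \in s ->
  component F x = [set y in s].
Proof.
move=> hs rs xs; have us := uniq_flatten_mem uss hs.
have adj a b : a \in s -> adjacent F a b -> b \in s.
  move=> ha /existsP[e /and3P[/FP[t ht et] ae be]].
  by rewrite (uniq_flatten_inj uss hs ht ha) ?(window_subset et).
have adjC a b : adjacent F a b = adjacent F b a.
  by apply/existsP/existsP => -[e /and3P[h1 h2 h3]]; exists e; rewrite h1 h2 h3.
have conC : connect_sym (adjacent F) by apply: sym_connect_sym => a b; apply: adjC.
apply/setP => y; rewrite !inE; apply/idP/idP.
  move=> /connectP[p]; elim: p x xs => [|z p IH] x xs /=; first by move=> _ ->.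
  move=> /andP[xz pz] E; apply: (IH z) => //; exact: adj xz.
move=> ys.
have step i : i.+1 < size s -> adjacent F (nth x s i) (nth x s i.+1).
  move=> hi; have [j [j1 j2 j3]] : exists j, [/\ j + r <= size s, j <= i & i.+1 < j + r].
    by exists (minn i (size s - r)); split; lia.
  apply/existsP; exists [set x in take r (drop j s)]; apply/and3P; split.
  - by apply/FP; exists s => //; apply/windowsP; exists j.
  - by rewrite inE mem_take_drop // mem_nth ?index_uniq ?j2 ?(ltnW j3) // ltnW.
  - by rewrite inE mem_take_drop // mem_nth ?index_uniq // j3 andbT leqW.
have from0 i : i < size s -> connect (adjacent F) (nth x s 0) (nth x s i).
  elim: i => [|i IH] hi; first exact: connect0.
  by apply: connect_trans (IH _) (connect1 (step _ hi)); lia.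
apply: connect_trans (_ : connect _ (nth x s 0) _); last first.
  by rewrite -(nth_index x ys) from0 // index_mem.
by rewrite conC -{2}(nth_index x xs) from0 // index_mem.
Qed.

Lemma component_isolated x :
  (forall s, s \in ss -> r <= size s -> x \notin s) -> component F x = [set x].
Proof.
move=> hx; apply/setP => y; rewrite !inE; apply/idP/eqP => [|->]; last exact: connect0.
move=> /connectP[[|z p] /=]; first by move=> _ ->.
move=> /andP[/existsP[e /and3P[/FP[t ht et] xe _]] _] _.
have /windowsP[i ri _] := et.
have : x \notin t by apply: hx => //; lia.
by rewrite (window_subset et).
Qed.

Lemma packing_is_forest : is_tight_linear_forest r F.
Proof.
split.
  by move=> e /FP[s hs]; apply: card_window; apply: uniq_flatten_mem hs.
move=> x V; have [/hasP[s hs /andP[rs xs]]|/hasPn hx] :=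
  boolP (has (fun s => (r <= size s) && (x \in s)) ss).
  have us := uniq_flatten_mem uss hs.
  left; exists s; split => //; first exact: component_packing.
  rewrite /V (component_packing hs) //; apply/setP => e; rewrite inE; apply/andP/imsetP.
    move=> [/FP[t ht et] /subsetP es].
    have /card_gt0P[y ye] : 0 < #|e|.
      by rewrite (card_window (uniq_flatten_mem uss ht) et); lia.
    have ys : y \in s by have := es _ ye; rewrite inE.
    have st : s = t := uniq_flatten_inj uss hs ht ys (window_subset et ye).
    have /windowsP[i hi ->] : e \in windows r s by rewrite st.
    have hi' : i < (size s).+1 - r by rewrite ltn_subRL addnC ltnS.
    by exists (Ordinal hi').
  move=> [i _ ->]; have := ltn_ord i; rewrite ltn_subRL addnC ltnS => hi; split.
    by apply/FP; exists s => //; apply/windowsP; exists (val i).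
  by apply/subsetP => y; rewrite !inE => /mem_take/mem_drop.
right; have hx' s : s \in ss -> r <= size s -> x \notin s.
  by move=> hs rs; have := hx s hs; rewrite rs.
rewrite /V component_isolated //; split; first exact: cards1.
apply/setP => e; rewrite !inE; apply/negP => /andP[eF /subset_leq_card].
have /FP[s hs es] : e \in F by rewrite inE.
by rewrite cards1 (card_window (uniq_flatten_mem uss hs) es) leqNgt r1.
Qed.

End PackingForest.

Lemma packing_contains_forest (r : nat) H ss k : 1 < r -> tight_packing r H ss ->
  k <= \sum_(s <- ss) ((size s).+1 - r) ->
  exists F : {set {set T}}, tight_linear_forests r #|T| k F /\ contains_copy H F.
Proof.
move=> r1 pss hk; have r0 : 0 < r by apply: ltnW.
have {pss hk} [{}ss [[uss wss] Ek]] := trim_packing r0 pss hk.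
exists [set e in flatten [seq windows r s | s <- ss]]; split.
  split=> //; first exact: packing_is_forest.
  rewrite cardsE; have /card_uniqP -> := uniq_flatten_windows r0 uss.
  rewrite size_flatten /shape -map_comp sumnE big_map -Ek.
  by apply: eq_bigr => s _; rewrite /= size_windows.
exists id; split; first by move=> x y.
apply/subsetP => _ /imsetP[e + ->]; rewrite inE => /flattenP[_ /mapP[s hs ->] es].
by rewrite imset_id; apply: (wss s).
Qed.

Lemma forest_degree (r : nat) H x : 0 < r -> is_tight_linear_forest r H ->
  #|[set e in H | x \in e]| <= r.
Proof.
move=> r0 [rH /(_ x)] /=; set V := component H x.
have sub : [set e in H | x \in e] \subset [set e in induced_edges H V | x \in e].
  apply/subsetP => e; rewrite !inE => /andP[eH xe]; rewrite eH xe andbT /=.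
  apply/subsetP => y ye; rewrite inE; apply: connect1; apply/existsP; exists e.
  by rewrite eH xe ye.
have := subset_leq_card sub; move=> /leq_trans h; case=> [[s [us EV EE]]|[_ E]]; apply: h; last first.
  by rewrite E (leq_trans _ (leq0n r)) // leqn0 cards_eq0; apply/eqP/setP => e; rewrite !inE.
rewrite EE; have [xs|xs] := boolP (x \in s); last first.
  apply: (@leq_trans 0) => //; rewrite leqn0 cards_eq0; apply/eqP/setP => e; rewrite !inE.
  by apply/negP => /andP[/imsetP[i _ ->]]; rewrite inE => /mem_take/mem_drop; rewrite (negbTE xs).
pose f (j : 'I_r) := [set y in take r (drop (index x s - j) s)].
apply: (@leq_trans #|f @: setT|); last first.
  by apply: leq_trans (leq_imset_card _ _) _; rewrite cardsT card_ord.
apply/subset_leq_card/subsetP => e; rewrite !inE => /andP[/imsetP[i _ ->]].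
rewrite inE mem_take_drop // xs /= => /andP[h1 h2].
have hj : index x s - i < r by lia.
by apply/imsetP; exists (Ordinal hj); rewrite //= /f /= subKn.
Qed.

End Windows.

(** * Sets of small weight *)

Local Open Scope ring_scope.

Lemma card_draws_mem (T : finType) (B : {set T}) (k : nat) (x : T) :
  x \in B ->
  #|[set f : {set T} | [&& f \subset B, #|f| == k.+1 & x \in f]]| = 'C(#|B|.-1, k).
Proof.
move=> xB.
have := cards_draws B k.+1.
rewrite -(cardsID [set f : {set T} | x \in f]).
have -> : [set A : {set T} | A \subset B & #|A| == k.+1] :\: [set f : {set T} | x \in f]
  = [set A : {set T} | A \subset B :\ x & #|A| == k.+1].
  by apply/setP=> f; rewrite !inE subsetD1; case: (x \in f); rewrite ?andbF ?andbT.
rewrite cards_draws (cardsD1 x B) xB /= add1n binS addnC => /addnI.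
by move=> <-; apply: eq_card => f; rewrite !inE andbA.
Qed.

Lemma sum_draws_weight (R : numDomainType) (T : finType) (w : T -> R) (B : {set T}) (k : nat) :
  \sum_(f : {set T} | (f \subset B) && (#|f| == k.+1)) \sum_(x in f) w x
  = 'C(#|B|.-1, k)%:R * \sum_(x in B) w x.
Proof.
rewrite (exchange_big_dep (fun x => x \in B)) /=; last first.
  by move=> f x /andP[/subsetP fB _] /fB.
rewrite mulr_sumr; apply: eq_bigr => x xB.
rewrite sumr_const -(card_draws_mem k xB) mulr_natl; congr (_ *+ _).
by apply: eq_card => f; rewrite !inE unfold_in /= andbA.
Qed.

(* Charging each heavy set e to e - x with weight w x. *)
Lemma card_heavy_le (R : realDomainType) (T : finType) (w : T -> R) (B : {set T})
    (k : nat) (a : R) :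
  (forall x, 0 <= w x) -> (forall x, x \in B -> w x <= a) ->
  #|[set e : {set T} | [&& e \subset B, #|e| == k.+1 & 1 <= \sum_(x in e) w x]]|%:R
  <= (\sum_(x in B) w x) *
     #|[set f : {set T} | [&& f \subset B, #|f| == k & 1 <= a + \sum_(x in f) w x]]|%:R.
Proof.
move=> w0 wa; set F := [set e | _]; set G := [set f | _].
apply: (@le_trans _ _ (\sum_(e in F) \sum_(x in e) w x)).
  rewrite -sum1_card natr_sum; apply: ler_sum => e.
  by rewrite inE => /and3P[].
rewrite (exchange_big_dep (fun x => x \in B)) /=; last first.
  by move=> e x; rewrite inE => /and3P[/subsetP eB _ _] /eB.
rewrite mulr_suml; apply: ler_sum => x xB.
rewrite sumr_const -[w x *+ _]mulr_natr; apply: ler_wpM2l; first exact: w0.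
rewrite ler_nat.
rewrite -(@card_in_imset _ _ (fun e : {set T} => e :\ x)
   [pred e : {set T} | (e \in F) && (x \in e)]); last first.
  move=> e1 e2 /andP[_ x1] /andP[_ x2] /= E.
  by rewrite -(setD1K x1) -(setD1K x2) E.
apply/subset_leq_card/subsetP => f /imsetP[e /andP[]].
rewrite inE => /and3P[eB /eqP ek ew] xe ->; rewrite inE.
apply/and3P; split.
- by apply: subset_trans eB; apply: subsetDl.
- by move: ek; rewrite (cardsD1 x e) xe add1n => -[->].
- move: ew; rewrite (big_setD1 x) //= => /le_trans; apply.
  by rewrite lerD2r wa.
Qed.

Definition gap (R : pzRingType) (a : nat -> R) (i : nat) : R :=
  (if i is i'.+1 then a i' else 1) - a i.

Lemma sum_gap (R : pzRingType) (a : nat -> R) (n : nat) :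
  \sum_(i < n.+1) gap a i = 1 - a n.
Proof.
elim: n => [|n IH]; first by rewrite big_ord1.
by rewrite big_ord_recr IH /= /gap addrA subrK.
Qed.

Lemma sum_prefix_le (R : realDomainType) (a : nat -> R) (y : R) (m : nat) :
  a 0 <= 1 -> {homo a : i j / (i <= j)%N >-> j <= i} -> 0 <= y ->
  \sum_(i < m | 1 <= a i + y) gap a i <= y.
Proof.
move=> a0 am y0.
have d0 i : 0 <= gap a i by case: i => [|i]; rewrite /gap subr_ge0 //; apply: am.
elim: m => [|m IH]; first by rewrite big_ord0.
have [h|h] := boolP (1 <= a m + y); last by rewrite big_mkcond big_ord_recr /= (negbTE h) addr0 -big_mkcond.
apply: (@le_trans _ _ (\sum_(i < m.+1) gap a i)).
  by rewrite big_mkcond /=; apply: ler_sum => i _; case: ifP.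
by rewrite sum_gap lerBlDl.
Qed.

Lemma sum_abel_drop (R : comNzRingType) (a : nat -> R) (q : nat) :
  \sum_(i < q) (q - i)%:R * gap a i = q%:R - \sum_(i < q) a i.
Proof.
elim: q => [|q IH]; first by rewrite !big_ord0 subr0.
have -> : \sum_(i < q.+1) (q.+1 - i)%:R * gap a i
   = \sum_(i < q.+1) (q - i)%:R * gap a i + \sum_(i < q.+1) gap a i.
  rewrite -big_split; apply: eq_bigr => i _.
  by rewrite subSn ?leq_ord // -addn1 natrD mulrDl mul1r.
rewrite sum_gap big_ord_recr /= subnn mul0r addr0 IH big_ord_recr /= -addn1 natrD; ring.
Qed.

Lemma exists_top_set (R : realDomainType) (T : finType) (w : T -> R) (A : {set T}) (q : nat) :
  (q <= #|A|)%N ->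
  exists s : seq T, [/\ uniq s, size s = q, {subset s <= A},
    sorted (fun x y => w y <= w x) s &
    forall x y, x \in s -> y \in A -> y \notin s -> w y <= w x].
Proof.
move=> qA.
set le := fun x y => w y <= w x.
have le_tr : transitive le by move=> y x z /= h1 h2; apply: le_trans h2 h1.
have le_tot : total le by move=> x y; rewrite /le le_total.
set s := sort le (enum A).
have us : uniq s by rewrite sort_uniq enum_uniq.
have ss : size s = #|A| by rewrite size_sort cardE.
have ms x : (x \in s) = (x \in A) by rewrite mem_sort mem_enum.
have sos : sorted le s by apply: sort_sorted.
exists (take q s); split.
- exact: take_uniq.
- by rewrite size_take ss; case: ltngtP qA.
- by move=> x /mem_take; rewrite ms.
- exact: take_sorted.
- move=> x y xs yA yn.
  have : y \in drop q s.
    by have := ms y; rewrite yA -{1}(cat_take_drop q s) mem_cat (negbTE yn).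
  move: sos; rewrite sorted_pairwise // -{1}(cat_take_drop q s) pairwise_cat.
  by move=> /and3P[/allrelP H _ _] yd; apply: H.
Qed.

Definition light_draws (R : numDomainType) (T : finType) (w : T -> R) (B : {set T})
    (k : nat) (b : R) : {set {set T}} :=
  [set f : {set T} | [&& f \subset B, #|f| == k & ~~ (1 <= b + \sum_(x in f) w x)]].

Definition heavy_draws (R : numDomainType) (T : finType) (w : T -> R) (B : {set T})
    (k : nat) (b : R) : {set {set T}} :=
  [set f : {set T} | [&& f \subset B, #|f| == k & 1 <= b + \sum_(x in f) w x]].

Lemma card_light_heavy (R : numDomainType) (T : finType) (w : T -> R) (B : {set T})
    (k : nat) (b : R) :
  (#|light_draws w B k b| + #|heavy_draws w B k b|)%N = 'C(#|B|, k).
Proof.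
rewrite -cards_draws addnC -(cardsID [set f : {set T} | 1 <= b + \sum_(x in f) w x]).
by congr (_ + _)%N; apply: eq_card => f; rewrite !inE;
  case: (f \subset B); case: (#|f| == k); rewrite ?andbF ?andbT.
Qed.

Lemma card_light_split (R : numDomainType) (T : finType) (w : T -> R) (S : {set T}) (k : nat) :
  (#|light_draws w (~: S) k.+1 0| + \sum_(x in S) #|light_draws w (~: S) k (w x)|
   <= #|light_draws w setT k.+1 0|)%N.
Proof.
set X := [set p : T * {set T} | (p.1 \in S) && (p.2 \in light_draws w (~: S) k (w p.1))].
have memS (p : T * {set T}) : p \in X -> forall y, y \in S -> (y \in p.1 |: p.2) = (y == p.1).
  rewrite inE => /andP[pS]; rewrite inE => /and3P[/subsetP fS _ _] y yS.
  rewrite !inE; case: eqP => //= _; apply/negP => /fS; by rewrite inE yS.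
have out (p : T * {set T}) : p \in X -> p.1 \notin p.2.
  rewrite inE => /andP[pS]; rewrite inE => /and3P[/subsetP fS _ _].
  by apply/negP => /fS; rewrite inE pS.
have cX : #|X| = \sum_(x in S) #|light_draws w (~: S) k (w x)|.
  rewrite -sum1_card; under [RHS]eq_bigr do rewrite -sum1_card.
  by rewrite pair_big_dep; apply: eq_bigl => p; rewrite inE.
have cI : #|[set p.1 |: p.2 | p in X]| = #|X|.
  apply: card_in_imset => -[x f] [y g] pX qX /= E.
  have xy : x = y.
    have /= := memS _ qX x; rewrite -E setU11 => /(_ _)/esym/eqP; apply.
    by move: pX; rewrite inE => /andP[].
  subst y; congr (_, _).
  have /= of_ := out _ pX; have /= og := out _ qX.
  by rewrite -(setU1K of_) E (setU1K og).
rewrite -cX -cI -cardsUI.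
have -> : light_draws w (~: S) k.+1 0 :&: [set p.1 |: p.2 | p in X] = set0.
  apply/setP => e; rewrite !inE; apply/negP => /andP[/and3P[/subsetP eS _ _]].
  case/imsetP => -[x f] pX /= Ee.
  have := eS x; rewrite Ee setU11 inE => /(_ isT).
  by move: pX; rewrite inE => /andP[/= ->].
rewrite cards0 addn0; apply/subset_leq_card/subsetP => e; rewrite inE => /orP[].
  by rewrite !inE => /and3P[_ -> ->]; rewrite subsetT.
case/imsetP => -[x f] pX /= Ee; have := out _ pX; move: pX.
rewrite inE /= => /andP[xS]; rewrite !inE => /and3P[_ /eqP fk fw] xf.
by rewrite subsetT Ee cardsU1 xf fk eqxx big_setU1 //= add0r.
Qed.

Lemma heavy_few (R : realFieldType) (T : finType) (w : T -> R) (q k : nat) (S : {set T}) (s : seq T) :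
  (0 < q)%N -> (0 < k)%N ->
  (forall x, 0 <= w x) -> (forall x, w x <= 1) -> \sum_x w x < q%:R ->
  uniq s -> size s = q -> S = [set x in s] ->
  sorted (fun x y => w y <= w x) s ->
  (forall x y, x \in s -> y \notin s -> w y <= w x) ->
  (2 * q * k + q <= #|T|)%N ->
  (#|heavy_draws w (~: S) k.+1 0| <= \sum_(x in S) #|light_draws w (~: S) k (w x)|)%N.
Proof.
move=> q0 k0 w0 w1 wq us sq ES sos top nT.
rewrite leqNgt; apply/negP => ltF.
have [x0 x0s] : exists x0, x0 \in s by case: (s) sq q0 => [<-//|x0 s' _ _]; exists x0; rewrite mem_head.
pose a i := w (nth x0 s (minn i q.-1)).
have am : {homo a : i j / (i <= j)%N >-> j <= i}.
  move=> i j ij; rewrite /a.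
  have le_tr : transitive (fun x y => w y <= w x) by move=> y x z /= h1 h2; apply: le_trans h2 h1.
  have le_rf : reflexive (fun x y => w y <= w x) by move=> x /=; rewrite lexx.
  by apply: (sorted_leq_nth le_tr le_rf x0 sos); rewrite ?inE ?sq; lia.
have cS : #|S| = q by rewrite ES cardsE (card_uniqP us).
set B := ~: S in ltF *.
have cB : #|B| = (#|T| - q)%N by rewrite -cS cardsCs setCK.
set N := #|B| in cB.
have nN : (2 * q * k <= N)%N by lia.
pose P : R := 'C(N, k)%:R.
pose G i := #|heavy_draws w B k (a i)|.
pose L i := #|light_draws w B k (a i)|.
have LG i : (L i)%:R + (G i)%:R = P by rewrite -natrD card_light_heavy.
have sumS (F : T -> R) : \sum_(x in S) F x = \sum_(i < q) F (nth x0 s i).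
  rewrite ES; under eq_bigl do rewrite inE.
  by rewrite -big_uniq // (big_nth x0) big_mkord sq.
have aE i : (i < q)%N -> a i = w (nth x0 s i).
  by move=> iq; rewrite /a; congr (w (nth _ _ _)); lia.
have wS : \sum_(x in S) w x = \sum_(i < q) a i.
  by rewrite sumS; apply: eq_bigr => i _; rewrite aE.
have wT : \sum_(x in S) w x + \sum_(x in B) w x = \sum_x w x.
  rewrite [RHS](bigID (fun x => x \in S)) /=; congr (_ + _).
  by apply: eq_bigl => x; rewrite inE.
have Gm i j : (i <= j)%N -> (G j <= G i)%N.
  move=> ij; apply/subset_leq_card/subsetP => f; rewrite !inE => /and3P[-> -> /le_trans ->] //.
  by rewrite lerD2r am.
have F0 : #|heavy_draws w B k.+1 0|%:R <= (\sum_(x in B) w x) * (G q.-1)%:R.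
  have -> : heavy_draws w B k.+1 0 =
      [set e : {set T} | [&& e \subset B, #|e| == k.+1 & 1 <= \sum_(x in e) w x]].
    by apply/setP => e; rewrite !inE add0r.
  apply: card_heavy_le => //.
  move=> x; rewrite inE ES inE => xs; rewrite /a minnn; apply: top => //.
  by apply: mem_nth; rewrite sq ltn_predL.
have wS0 : 0 <= \sum_(x in S) w x by apply: sumr_ge0.
have wB0 : 0 <= \sum_(x in B) w x by apply: sumr_ge0.
have wBq : \sum_(x in B) w x <= q%:R by lra.
have G0 i : 0 <= (G i)%:R :> R by [].
have lt : \sum_(i < q) (L i)%:R < q%:R * (G q.-1)%:R :> R.
  apply: lt_le_trans (le_trans F0 _); last by apply: ler_wpM2r.
  rewrite -[X in _ < X]/(_%:R) -natr_sum ltr_nat; apply: leq_ltn_trans ltF.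
  rewrite -(@ler_nat R) !natr_sum sumS; apply: ler_sum => i _.
  by rewrite /L aE.
have key i : (i < q)%N -> (q - i)%:R * P <= 2 * q%:R * (G i)%:R.
  move=> iq; rewrite leNgt; apply/negP => h.
  have h1 : (q - i)%:R * (P - (G i)%:R) <= \sum_(j < q) (L j)%:R.
    apply: (@le_trans _ _ (\sum_(i <= j < q) (L j)%:R)); last first.
      rewrite [X in _ <= X](_ : _ = \sum_(0 <= j < q) (L j)%:R); last by rewrite big_mkord.
      rewrite [X in _ <= X](big_cat_nat (n := i)) //= ?lerDr; last exact: ltnW.
      by apply: sumr_ge0.
    rewrite mulr_natl -sumr_const_nat big_nat_cond [X in _ <= X]big_nat_cond; apply: ler_sum => j /andP[/andP[ij _] _].
    by rewrite lerBlDr -(LG j) lerD2l ler_nat Gm.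
  have h2 : (G q.-1)%:R <= (G i)%:R :> R by rewrite ler_nat Gm // -ltnS prednK.
  have h3 : q%:R * (G q.-1)%:R <= q%:R * (G i)%:R :> R by apply: ler_wpM2l.
  have h4 : (q - i)%:R * (G i)%:R <= q%:R * (G i)%:R :> R.
    by apply: ler_wpM2r => //; rewrite ler_nat leq_subr.
  by lra.
have a01 : a 0%N <= 1 by apply: w1.
have q2 : (0 < 2 * q)%N by rewrite muln_gt0.
have P0 : 0 < P by rewrite ltr0n bin_gt0 (leq_trans _ nN) // leq_pmull.
have wf : \sum_(i < q) gap a i * (G i)%:R <= \sum_(f : {set T} | (f \subset B) && (#|f| == k)) \sum_(x in f) w x.
  apply: (@le_trans _ _ (\sum_(f : {set T} | (f \subset B) && (#|f| == k))
     \sum_(i < q | 1 <= a i + \sum_(x in f) w x) gap a i)); last first.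
    by apply: ler_sum => f _; apply: sum_prefix_le => //; apply: sumr_ge0.
  rewrite (exchange_big_dep predT) //=; apply: ler_sum => i _.
  rewrite sumr_const mulr_natr; rewrite le_eqVlt; apply/orP; left; apply/eqP; congr (_ *+ _).
  by apply: eq_card => f; rewrite !inE unfold_in /= andbA.
have gap0 i : 0 <= gap a i by case: i => [|i]; rewrite /gap subr_ge0 //; apply: am.
have h5 : P * (q%:R - \sum_(x in S) w x) <= 2 * q%:R * \sum_(f : {set T} | (f \subset B) && (#|f| == k)) \sum_(x in f) w x.
  apply: (@le_trans _ _ (2 * q%:R * \sum_(i < q) gap a i * (G i)%:R)); last first.
    by apply: ler_wpM2l => //; rewrite mulr_ge0.
  rewrite wS -sum_abel_drop !mulr_sumr; apply: ler_sum => i _.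
  by have := ler_wpM2l (gap0 i) (key i (ltn_ord i)); lra.
have [k' Ek] : exists k', k = k'.+1 by exists k.-1; rewrite prednK.
move: h5; rewrite Ek sum_draws_weight -/N => h5.
have h6 : N%:R * 'C(N.-1, k')%:R = k%:R * P :> R by rewrite /P Ek -!natrM mul_bin_diag.
have h7 : P * N%:R * (q%:R - \sum_(x in S) w x) <= P * N%:R * \sum_(x in B) w x.
  have h8 : P * N%:R * (q%:R - \sum_(x in S) w x) <= P * (2 * q%:R * k%:R) * \sum_(x in B) w x.
    have := ler_wpM2l (ler0n R N) h5.
    set W := \sum_(x in B) _; set C : R := 'C(_, _)%:R in h6 *.
    have -> : N%:R * (2 * q%:R * (C * W)) = 2 * q%:R * (N%:R * C) * W by ring.
    rewrite h6; lra.
  apply: le_trans h8 _; apply: ler_wpM2r => //; apply: ler_wpM2l; first exact: ltW.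
  by rewrite -!natrM ler_nat.
move: h7; rewrite ler_pM2l; first by lra.
by rewrite mulr_gt0 // ltr0n (leq_trans _ nN) // muln_gt0 q2.
Qed.

(* Truncating w at 1 does not change which sets have weight less than 1. *)
Lemma card_light_ge (R : realFieldType) (T : finType) (w : T -> R) (q k : nat) :
  (0 < k)%N -> (forall x, 0 <= w x) -> \sum_x w x < q%:R -> (2 * q * k + q <= #|T|)%N ->
  ('C(#|T| - q, k.+1) <= #|[set e : {set T} | (#|e| == k.+1) && (\sum_(x in e) w x < 1)%R]|)%N.
Proof.
move=> k0 w0 wq nT.
pose v x := Num.min (w x) 1.
have v0 x : 0 <= v x by rewrite /v le_min w0 ler01.
have v1 x : v x <= 1 by rewrite /v ge_min lexx orbT.
have vw x : v x <= w x by rewrite /v ge_min lexx.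
have vq : \sum_x v x < q%:R by apply: le_lt_trans wq; apply: ler_sum.
have q0 : (0 < q)%N.
  by rewrite -(@ltr0n R); apply: le_lt_trans vq; apply: sumr_ge0.
have qT : (q <= #|[set: T]|)%N by rewrite cardsT; lia.
have [s [us ss _ sos top]] := exists_top_set v qT.
pose S := [set x in s].
have top' x y : x \in s -> y \notin s -> v y <= v x by move=> xs ys; apply: top.
have := heavy_few q0 k0 v0 v1 vq us ss (erefl S) sos top' nT.
have cS : #|S| = q by rewrite /S cardsE (card_uniqP us).
have cB : #|~: S| = (#|T| - q)%N by rewrite -cS -(cardsC S) addKn.
have := card_light_heavy v (~: S) k.+1 0; rewrite cB => <- hl.
apply: leq_trans (leq_add (leqnn _) hl) _.
apply: leq_trans (card_light_split _ _ _) _.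
apply/subset_leq_card/subsetP => e; rewrite !inE subsetT /= add0r -ltNge => /andP[-> ve] /=.
suff -> : \sum_(x in e) w x = \sum_(x in e) v x by [].
apply: eq_bigr => x xe; rewrite /v; case: (lerP (w x) 1) => // wx.
move: ve; rewrite (big_setD1 x) //= {1}/v (min_r (ltW wx)).
rewrite gtrDl ltNge => /negP[]; exact: sumr_ge0.
Qed.

(** * Tuples of vertex sets rich in tight paths *)

Lemma exists_subset_card (T : finType) (A : {set T}) (m : nat) :
  (m <= #|A|)%N -> exists2 Y : {set T}, Y \subset A & #|Y| = m.
Proof.
move=> mA; exists [set x in take m (enum A)].
  by apply/subsetP => x; rewrite inE => /mem_take; rewrite mem_enum.
rewrite cardsE; have /card_uniqP -> : uniq (take m (enum A)) by rewrite take_uniq ?enum_uniq.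
by rewrite size_takel // -cardE.
Qed.

Lemma exists_equipartition (T : finType) (D m : nat) (A : {set T}) :
  #|A| = (D * m)%N ->
  exists g : T -> nat, (forall x, x \in A -> (g x < D)%N) /\
    forall d, (d < D)%N -> #|[set x in A | g x == d]| = m.
Proof.
elim: D A => [|D IH] A cA.
  exists (fun=> 0%N); split => // x xA.
  by move: cA; rewrite mul0n => /eqP; rewrite cards_eq0 => /eqP A0; rewrite A0 inE in xA.
have [|Y YA cY] := @exists_subset_card _ A m; first by rewrite cA mulSn leq_addr.
have cAY : #|A :\: Y| = (D * m)%N by rewrite cardsDS // cA cY mulSn addKn.
have [g [g1 g2]] := IH _ cAY.
exists (fun x => if x \in Y then 0%N else (g x).+1); split.
  by move=> x xA; case: ifP => // xY; rewrite ltnS g1 // inE xY.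
case=> [|d] dD.
  rewrite -[RHS]cY; apply: eq_card => x; rewrite !inE; case: ifP => xY; rewrite ?andbF //.
  by rewrite andbT (subsetP YA).
rewrite -[RHS](g2 d) //; apply: eq_card => x; rewrite !inE; case: ifP => xY //=.
by rewrite andbF.
Qed.

Lemma exists_equipartition_with (T : finType) (D m : nat) (A Y : {set T}) :
  #|A| = (D.+1 * m)%N -> Y \subset A -> #|Y| = m ->
  exists g : T -> 'I_D.+1, (forall d, #|[set x in A | g x == d]| = m) /\
    [set x in A | g x == ord0] = Y.
Proof.
move=> cA YA cY.
have cAY : #|A :\: Y| = (D * m)%N by rewrite cardsDS // cA cY mulSn addKn.
have [g [g1 g2]] := exists_equipartition cAY.
pose g' x : 'I_D.+1 := if x \in Y then ord0 else inord (g x).+1.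
have g'0 : [set x in A | g' x == ord0] = Y.
  apply/setP => x; rewrite !inE /g'; case: ifP => xY; first by rewrite eqxx andbT (subsetP YA).
  apply/negP => /andP[xA /eqP/(congr1 val)]; rewrite /= inordK //.
  by rewrite ltnS g1 // inE xY.
exists g'; split => // d; have [->|d0] := eqVneq d ord0; first by rewrite g'0.
have dE : val d = (val d).-1.+1 by rewrite prednK // lt0n.
have dD : ((val d).-1 < D)%N by rewrite -ltnS -dE ltn_ord.
rewrite -(g2 _ dD); apply: eq_card => x; rewrite !inE /g'; case: ifP => xY /=.
  by rewrite eq_sym (negbTE d0) andbF.
have [xA|] //= := boolP (x \in A).
have gD : ((g x).+1 < D.+1)%N by rewrite ltnS g1 // inE xY.
by rewrite -val_eqE /= inordK // [X in (_ == X) = _]dE eqSS.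
Qed.

Section Density.
Context {I V : finType}.
Implicit Types (X : {set {ffun I -> V}}) (A Y : I -> {set V}).

Definition edges_in X A : {set {ffun I -> V}} :=
  [set v in X | [forall j, v j \in A j]].

Lemma edges_inP X A v :
  reflect (v \in X /\ forall j, v j \in A j) (v \in edges_in X A).
Proof. by rewrite inE; apply: (iffP andP) => -[-> /forallP]. Qed.

Lemma card_box A : #|[set v : {ffun I -> V} | [forall j, v j \in A j]]| = (\prod_j #|A j|)%N.
Proof.
rewrite (_ : #|_| = #|(family (fun j => mem (A j)) : simpl_pred {ffun I -> V})|).
  by rewrite card_family foldrE big_map big_enum.
by apply: eq_card => v; rewrite inE; apply/forallP/familyP.
Qed.

Lemma card_edges_in_le X A m :
  (forall j, #|A j| = m) -> (#|edges_in X A| <= m ^ #|I|)%N.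
Proof.
move=> cA; apply: (@leq_trans #|[set v : {ffun I -> V} | [forall j, v j \in A j]]|).
  by apply/subset_leq_card/subsetP => v /edges_inP[_ vA]; rewrite inE; apply/forallP.
by rewrite card_box; under eq_bigr do rewrite cA; rewrite prod_nat_const.
Qed.

Lemma card_edges_in_split X A Y D m :
  (0 < D)%N -> (0 < #|I|)%N -> (forall j, #|A j| = (D.+1 * m)%N) ->
  (forall j, Y j \subset A j) -> (forall j, #|Y j| = m) ->
  exists A', [/\ forall j, A' j \subset A j, forall j, #|A' j| = m &
    (#|edges_in X A| <= #|edges_in X Y| + (D.+1 ^ #|I|).-1 * #|edges_in X A'|)%N].
Proof.
move=> D0 I0 cA YA cY.
have /choice[g gP] : forall j, exists g : V -> 'I_D.+1,
    (forall d, #|[set x in A j | g x == d]| = m) /\ [set x in A j | g x == ord0] = Y j.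
  by move=> j; apply: exists_equipartition_with.
pose B (phi : {ffun I -> 'I_D.+1}) j := [set x in A j | g j x == phi j].
pose phi0 : {ffun I -> 'I_D.+1} := [ffun=> ord0].
pose phi1 : {ffun I -> 'I_D.+1} := [ffun=> ord_max].
have phi10 : phi1 != phi0.
  have /card_gt0P[j _] := I0; apply/eqP => /ffunP/(_ j); rewrite !ffunE => /(congr1 val) /=.
  by move=> E; rewrite E in D0.
have sumB : #|edges_in X A| = (\sum_phi #|edges_in X (B phi)|)%N.
  rewrite -sum1_card (partition_big (fun v : {ffun I -> V} => [ffun j => g j (v j)]) predT) //=.
  apply: eq_bigr => phi _; rewrite -sum1_card; apply: eq_bigl => v.
  apply/andP/edges_inP => [[/edges_inP[vX vA] /eqP/ffunP E]|[vX vB]].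
    by split=> // j; rewrite inE vA -(E j) ffunE eqxx.
  split; first by apply/edges_inP; split => // j; have := vB j; rewrite inE => /andP[].
  by apply/eqP/ffunP => j; rewrite ffunE; have := vB j; rewrite inE => /andP[_ /eqP].
pose phi := [arg max_(p > phi1 | p != phi0) #|edges_in X (B p)|].
have [phi_ne phi_max] : phi != phi0 /\
    forall p, p != phi0 -> (#|edges_in X (B p)| <= #|edges_in X (B phi)|)%N.
  by rewrite /phi; case: arg_maxnP.
exists (B phi); split.
- by move=> j; apply/subsetP => x; rewrite inE => /andP[].
- by move=> j; case: (gP j) => h _; apply: h.
rewrite sumB (bigD1 phi0) //=; apply: leq_add.
  apply/subset_leq_card/subsetP => v /edges_inP[vX vB]; apply/edges_inP; split => // j.
  by have := vB j; rewrite /B ffunE; case: (gP j) => _ ->.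
apply: (@leq_trans (\sum_(p | p != phi0) #|edges_in X (B phi)|)%N).
  by apply: leq_sum => p hp; apply: phi_max.
by rewrite sum_nat_const cardC1 card_ffun card_ord.
Qed.

(* Density increment: a subtuple of small density can be traded for one whose
   density is larger by a factor 1 + 1 / (2 * D.+1 ^ #|I|). *)
Lemma exists_good_tuple (R : realFieldType) X D m0 h (d : R) A :
  (0 < D)%N -> (0 < #|I|)%N -> (0 < m0)%N -> 0 <= d ->
  (forall j, #|A j| = (D.+1 ^ h * m0)%N) ->
  d * ((D.+1 ^ h * m0) ^ #|I|)%:R <= #|edges_in X A|%:R ->
  1 < d * (1 + (2 * (D.+1 ^ #|I|)%:R)^-1) ^+ h ->
  exists m A', [/\ (m0 <= m)%N, forall j, #|A' j| = (D.+1 * m)%N &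
    forall Y, (forall j, Y j \subset A' j) -> (forall j, #|Y j| = m) ->
      d / 2 * (m0 ^ #|I|)%:R <= #|edges_in X Y|%:R].
Proof.
move=> D0 I0 m00; elim: h d A => [|h IH] d A d0 cA dA.
  rewrite expr0 mulr1 => d1.
  have /card_edges_in_le : forall j, #|A j| = m0 by move=> j; rewrite cA expn0 mul1n.
  move=> /(_ X); rewrite -(ler_nat R) => /(le_trans dA); rewrite expn0 mul1n.
  by rewrite ger_pMl ?ltr0n ?expn_gt0 ?m00 // leNgt d1.
move=> d1; set m := (D.+1 ^ h * m0)%N.
have m0m : (m0 <= m)%N by rewrite leq_pmull // expn_gt0.
have cA' j : #|A j| = (D.+1 * m)%N by rewrite cA expnS -mulnA.
have [good|] := pselect (forall Y, (forall j, Y j \subset A j) -> (forall j, #|Y j| = m) ->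
      d / 2 * (m0 ^ #|I|)%:R <= #|edges_in X Y|%:R).
  by exists m, A.
move=> /existsNP[Y /not_implyP[YA /not_implyP[cY /negP]]]; rewrite -ltNge => bad.
have [A' [_ cA'' le]] := card_edges_in_split X D0 I0 cA' YA cY.
set eta := _^-1 in d1 IH; set Q : R := (D.+1 ^ #|I|)%:R in eta d1 IH.
have Q1 : 1 <= Q - 1.
  suff : 2%:R <= Q by lra.
  rewrite /Q ler_nat; case: #|I| I0 => // i _.
  by rewrite expnS (leq_trans (_ : 2 <= D.+1)%N) // leq_pmulr // expn_gt0.
have eta0 : 0 < eta by rewrite invr_gt0; lra.
have etaQ : eta * Q = 2^-1.
  by rewrite /eta invfM -mulrA mulVf ?mulr1 //; apply/eqP; lra.
have [||||m' [A0 [h1 h2 h3]]] := IH (d * (1 + eta)) A' _ _ _ _.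
- by rewrite mulr_ge0 //; lra.
- by [].
- have : (#|edges_in X A|%:R <= #|edges_in X Y|%:R + (Q - 1) * #|edges_in X A'|%:R :> R).
    move: le; rewrite -(ler_nat R) natrD natrM -subn1 natrB ?expn_gt0 //.
  move: dA; rewrite expnS -mulnA -/m expnMn natrM -/Q.
  have : d / 2 * (m0 ^ #|I|)%:R <= d / 2 * (m ^ #|I|)%:R.
    by apply: ler_wpM2l; rewrite ?divr_ge0 // ler_nat leq_exp2r.
  set M : R := (m ^ _)%:R; move: bad; set eY : R := #|edges_in X Y|%:R.
  set e' : R := #|edges_in X A'|%:R; set e : R := #|edges_in X A|%:R.
  move=> bad mm dA le'; have dM : 0 <= d * M by rewrite mulr_ge0.
  have key : (Q - 1) * (d * (1 + eta) * M) <= (Q - 1) * e'.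
    apply: (@le_trans _ _ ((Q - 2^-1) * (d * M))); last first.
      have E : d * (Q * M) = Q * (d * M) by ring.
      by rewrite E in dA; lra.
    have -> : (Q - 1) * (d * (1 + eta) * M) = (Q - 1 + (eta * Q) - eta) * (d * M) by ring.
    by rewrite etaQ; apply: ler_wpM2r => //; lra.
  by move: key; rewrite ler_pM2l //; lra.
- by rewrite -mulrA -exprS.
exists m', A0; split => // Y' Y'A cY'; apply: le_trans (h3 Y' Y'A cY').
apply: ler_wpM2r => //; rewrite ler_pM2r ?invr_gt0 // mulrDr mulr1 lerDl.
by rewrite mulr_ge0 // ltW.
Qed.
End Density.

Local Open Scope nat_scope.

Section Cleaning.
Context {I V : finType}.
Implicit Types (X : {set {ffun I -> V}}) (v : {ffun I -> V}).

Definition upd v (j : I) (x : V) : {ffun I -> V} := [ffun i => if i == j then x else v i].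

Lemma upd_id v j : upd v j (v j) = v.
Proof. by apply/ffunP => i; rewrite ffunE; case: eqP => [->|]. Qed.

Lemma upd_upd v j x y : upd (upd v j x) j y = upd v j y.
Proof. by apply/ffunP => i; rewrite !ffunE; case: eqP. Qed.

Lemma card_slab (j : I) (S : {set V}) :
  #|[set v : {ffun I -> V} | v j \in S]| = #|S| * #|V| ^ #|I|.-1.
Proof.
rewrite (_ : #|_| = #|[set v : {ffun I -> V} | [forall i, v i \in if i == j then S else setT]]|).
  rewrite card_box (bigD1 j) //= eqxx; congr (_ * _).
  under eq_bigr => i /negbTE -> do rewrite cardsT.
  by rewrite prod_nat_const cardC1.
apply: eq_card => v; rewrite !inE; apply/idP/forallP => [vj i|/(_ j)]; last by rewrite eqxx.
by case: eqP => [->|]; rewrite ?inE.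
Qed.

Lemma exists_robust_subset X (k : nat) :
  #|X| > k * (#|I| * #|V| ^ #|I|.-1) ->
  exists X' : {set {ffun I -> V}}, [/\ X' \subset X, X' != set0 &
    forall v j, v \in X' -> #|[set x | upd v j x \in X']| > k].
Proof.
have [/pred0P V0|/pred0Pn[x0 _]] := boolP (pred0b (mem V)).
  have [/pred0P I0|/pred0Pn[j _]] := boolP (pred0b (mem I)).
    move=> h; exists X; split => //; last by move=> v j; have := I0 j.
    by rewrite -card_gt0 (leq_ltn_trans _ h).
  move=> h; exists X; split => //; last by move=> v i; have := V0 (v i).
  by rewrite -card_gt0 (leq_ltn_trans _ h).
pose cls (Y : {set {ffun I -> V}}) j := [set upd v j x0 | v in Y].
have cls_le Y j : #|cls Y j| <= #|V| ^ #|I|.-1.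
  have := card_slab j [set x0]; rewrite cards1 mul1n => <-.
  apply/subset_leq_card/subsetP => _ /imsetP[v _ ->].
  by rewrite !inE ffunE eqxx.
suff main : forall X, #|X| > k * \sum_j #|cls X j| -> exists X' : {set {ffun I -> V}},
    [/\ X' \subset X, X' != set0 & forall v j, v \in X' -> #|[set x | upd v j x \in X']| > k].
  move=> h; apply: main; apply: leq_ltn_trans h; rewrite leq_mul2l; apply/orP; right.
  apply: (@leq_trans (\sum_(j : I) #|V| ^ #|I|.-1)); first by apply: leq_sum => j _; apply: cls_le.
  by rewrite sum_nat_const.
move=> {}X; move: {2}#|X| (leqnn #|X|) => m; elim: m X => [|m IH] X Xm h.
  by move: h; rewrite ltnNge (leq_trans Xm).
have [[v [j [vX vj]]]|good] :=
  pselect (exists v j, v \in X /\ #|[set x | upd v j x \in X]| <= k); last first.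
  exists X; split => //; first by rewrite -card_gt0 (leq_ltn_trans _ h).
  by move=> v j vX; rewrite ltnNge; apply/negP => vj; apply: good; exists v, j.
pose Y := [set upd v j x | x in [set x | upd v j x \in X]].
have YX : Y \subset X by apply/subsetP => _ /imsetP[x + ->]; rewrite inE.
have vY : v \in Y by apply/imsetP; exists (v j); rewrite ?inE upd_id.
have cY : #|Y| <= k by apply: leq_trans (leq_imset_card _ _) vj.
have cXY : #|X :\: Y| = #|X| - #|Y| by rewrite cardsDS.
have cY0 : 0 < #|Y| by apply/card_gt0P; exists v.
have cYX : #|Y| <= #|X| by apply: subset_leq_card.
have [||X' [X'1 X'2 X'3]] := IH (X :\: Y); last first.
- by exists X'; split => //; apply: subset_trans X'1 (subsetDl _ _).
- have lt : \sum_i #|cls (X :\: Y) i| < \sum_i #|cls X i|.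
    rewrite (bigD1 j) // [X in _ < X](bigD1 j) //= -addSn; apply: leq_add; last first.
      by apply: leq_sum => i _; apply/subset_leq_card/imsetS/subsetDl.
    apply/proper_card/properP; split; first by apply/imsetS/subsetDl.
    exists (upd v j x0); first by apply/imsetP; exists v.
    apply/negP => /imsetP[u]; rewrite inE => /andP[/negP uY uX] E; apply: uY.
    have uE : u = upd v j (u j).
      by rewrite -{1}(upd_id u j) -[LHS](upd_upd _ _ x0) -E upd_upd.
    by apply/imsetP; exists (u j); rewrite ?inE -uE.
  have := leq_mul (leqnn k) lt; rewrite mulnS => le1.
  by rewrite cXY; lia.
- by rewrite cXY; lia.
Qed.
End Cleaning.

Section CyclicPath.
Context {V : finType}.
Variable r : nat.
Implicit Types (X : {set {ffun 'I_r.+1 -> V}}).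

Let window_image (x0 : V) (p : seq V) (u : {ffun 'I_r.+1 -> V}) i :
  uniq p -> size p = i + r.+1 ->
  (forall t, t < r.+1 -> nth x0 p (i + t) = u (inZp (i + t))) ->
  [set x in take r.+1 (drop i p)] = [set u j | j in setT].
Proof.
move=> up sp pu; have sd : size (drop i p) = r.+1 by rewrite size_drop sp addKn.
rewrite take_oversize ?sd //; apply/eqP; rewrite eqEcard; apply/andP; split.
  apply/subsetP => y; rewrite inE => /(nthP x0)[t]; rewrite sd nth_drop => tr <-.
  by rewrite pu //; apply: imset_f.
apply: leq_trans (leq_imset_card _ _) _; rewrite cardsT card_ord cardsE.
have /card_uniqP -> : uniq (drop i p) by rewrite drop_uniq.
by rewrite sd.
Qed.

Lemma grow_path X (A : 'I_r.+1 -> {set V}) k m :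
  X != set0 -> (forall v, v \in X -> injective v) ->
  (forall v j, v \in X -> v j \in A j) ->
  (forall v j, v \in X -> #|[set x | upd v j x \in X]| > k) ->
  m + r.+1 <= k ->
  exists p : seq V, [/\ size p = m + r.+1, uniq p,
    forall x0 s, s < size p -> nth x0 p s \in A (inZp s) &
    forall e, e \in windows r.+1 p -> exists2 v, v \in X & e = [set v j | j in setT]].
Proof.
move=> /set0Pn[v0 v0X] Xinj XA Xk.
pose x0 := v0 ord0.
suff : m + r.+1 <= k ->
  exists p : seq V, exists u, [/\ [/\ size p = m + r.+1, uniq p & u \in X],
    forall t, t < r.+1 -> nth x0 p (m + t) = u (inZp (m + t)),
    forall s, s < size p -> nth x0 p s \in A (inZp s) &
    forall e, e \in windows r.+1 p -> exists2 v, v \in X & e = [set v j | j in setT]].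
  move=> h /h[p [u [[h1 h2 h3] h4 h5 h6]]]; exists p; split => // y0 s hs.
  by rewrite (set_nth_default x0) ?h5.
elim: m => [_|m IH hm].
  pose p := [seq v0 j | j <- enum 'I_r.+1].
  have sp : size p = r.+1 by rewrite size_map size_enum_ord.
  have pE t : t < r.+1 -> nth x0 p t = v0 (inZp t).
    move=> tr; rewrite (nth_map ord0) ?size_enum_ord //; congr (v0 _).
    by apply: val_inj; rewrite /= nth_enum_ord // modn_small.
  have up : uniq p by rewrite map_inj_uniq ?enum_uniq //; apply: Xinj.
  exists p, v0; split => //.
  - by move=> s; rewrite sp => /pE ->; apply: XA.
  - move=> e /windowsP[i hi ->]; exists v0 => //.
    have -> : i = 0 by move: hi; rewrite sp; lia.
    exact: (@window_image x0).
have [|p [u [[sp up uX] pu pA pW]]] := IH; first by apply: leq_trans hm; rewrite leq_add2r.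
pose j : 'I_r.+1 := inZp m.
have [x xX xp] : exists2 x, upd u j x \in X & x \notin p.
  have /subsetPn[x] : ~~ ([set x | upd u j x \in X] \subset [set x in p]).
    have cp : #|[set x in p]| = size p by rewrite cardsE; apply/card_uniqP.
    apply/negP => /subset_leq_card; rewrite cp leqNgt sp (leq_trans _ (Xk _ j uX)) //.
    by move: hm; rewrite addSn; lia.
  by rewrite !inE => h1 h2; exists x.
have jE : inZp (m + r.+1) = j by apply: val_inj; rewrite /= modnDr.
exists (rcons p x), (upd u j x).
have up' : uniq (rcons p x) by rewrite rcons_uniq xp up.
have sp' : size (rcons p x) = m.+1 + r.+1 by rewrite size_rcons sp.
have pu' t : t < r.+1 -> nth x0 (rcons p x) (m.+1 + t) = upd u j x (inZp (m.+1 + t)).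
  move=> tr; rewrite nth_rcons sp addSnnS ltn_add2l ffunE.
  case: (ltngtP t.+1 r.+1) => [tr'|tr'|->]; first last.
  - by rewrite eqxx jE eqxx.
  - by move: tr'; rewrite ltnNge tr.
  rewrite pu //; case: eqP => // /(congr1 val) /= /eqP.
  by rewrite -{2}(addn0 m) eqn_modDl mod0n modn_small.
split => //.
- move=> s; rewrite size_rcons ltnS leq_eqVlt nth_rcons => /orP[/eqP ->|sp1].
    rewrite ltnn eqxx sp jE; have := XA _ j xX; by rewrite ffunE eqxx.
  by rewrite sp1 pA.
- move=> e /windowsP[i]; rewrite size_rcons leq_eqVlt => /orP[/eqP hi|hi] ->.
    exists (upd u j x) => //; have -> : i = m.+1 by move: hi; rewrite sp; lia.
    exact: (@window_image x0).
  apply: pW; apply/windowsP; exists i; first by rewrite -ltnS.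
  congr ([set x in _]); rewrite -cats1 drop_cat; case: ltnP => ip; last by move: hi; lia.
  by rewrite takel_cat // size_drop; lia.
Qed.

End CyclicPath.

Local Open Scope ring_scope.

Lemma exists_nat_bound (R : archiRealFieldType) (x : R) :
  exists N : nat, forall n, (N <= n)%N -> x < n%:R.
Proof.
exists (Num.bound `|x|) => n hn; apply: le_lt_trans (ler_norm x) _.
by apply: lt_le_trans (archi_boundP (normr_ge0 x)) _; rewrite ler_nat.
Qed.

(* The tight path runs cyclically through the parts, hence [C (inZp s)]. *)
Definition path_rich (r : nat) (V : finType) (H : {set {set V}}) (L : nat)
    (B : 'I_r.+1 -> {set V}) (a : nat) : Prop :=
  forall C : 'I_r.+1 -> {set V}, (forall j, C j \subset B j) -> (forall j, (a <= #|C j|)%N) ->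
  exists p : seq V, [/\ size p = L, uniq p,
    forall x0 s, (s < size p)%N -> nth x0 p s \in C (inZp s) &
    {subset windows r.+1 p <= H}].

Definition ordered_edges (r : nat) (V : finType) (H : {set {set V}}) :
  {set {ffun 'I_r.+1 -> V}} := [set v : {ffun 'I_r.+1 -> V} | [set v j | j in setT] \in H].

Lemma ordered_edges_inj (r : nat) (V : finType) (H : {set {set V}})
    (v : {ffun 'I_r.+1 -> V}) :
  is_rgraph r.+1 H -> v \in ordered_edges r H -> injective v.
Proof.
move=> rH; rewrite inE => /rH cv.
have /imset_injP vi : #|[set v j | j in setT]| == #|[set: 'I_r.+1]| by rewrite cv cardsT card_ord.
by move=> i j; apply: vi; rewrite inE.
Qed.

Lemma card_ordered_edges (r : nat) (V : finType) (H : {set {set V}}) :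
  is_rgraph r.+1 H -> (#|H| <= #|ordered_edges r H|)%N.
Proof.
move=> rH; apply: leq_trans (leq_imset_card (fun v : {ffun 'I_r.+1 -> V} => [set v j | j in setT]) _).
apply/subset_leq_card/subsetP => e eH.
have ce : size (enum e) = r.+1 by rewrite -cardE rH.
have [x0 _] : exists x0, x0 \in enum e by case: (enum e) ce => // x s; exists x; rewrite mem_head.
pose v : {ffun 'I_r.+1 -> V} := [ffun j : 'I_r.+1 => nth x0 (enum e) j].
have ve : [set v j | j in setT] = e.
  apply/setP => x; apply/imsetP/idP => [[j _ ->]|xe].
    by rewrite ffunE -mem_enum mem_nth // ce.
  have xi : (index x (enum e) < r.+1)%N by rewrite -ce index_mem mem_enum.
  by exists (Ordinal xi); rewrite ?inE // ffunE nth_index // mem_enum.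
by apply/imsetP; exists v => //; rewrite inE ve.
Qed.

Lemma dense_box_path (r : nat) (V : finType) (H : {set {set V}}) k m
    (C : 'I_r.+1 -> {set V}) :
  is_rgraph r.+1 H -> (m + r.+1 <= k)%N ->
  (k * (r.+1 * #|V| ^ r) < #|edges_in (ordered_edges r H) C|)%N ->
  exists p : seq V, [/\ size p = (m + r.+1)%N, uniq p,
    forall x0 s, (s < size p)%N -> nth x0 p s \in C (inZp s) &
    {subset windows r.+1 p <= H}].
Proof.
move=> rH mk; have := @exists_robust_subset _ V (edges_in (ordered_edges r H) C) k.
rewrite card_ord => /[apply] -[X [/subsetP XC X0 Xk]].
have Xi v : v \in X -> injective v by move=> /XC/edges_inP[]/(ordered_edges_inj rH).
have XA v j : v \in X -> v j \in C j by move=> /XC/edges_inP[_ /(_ j) ->].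
have [p [h1 h2 h3 h4]] := grow_path X0 Xi XA Xk mk.
exists p; split => // e /h4[v /XC/edges_inP[]]; by rewrite inE => h _ ->.
Qed.

Lemma edges_in_setT_ge (r : nat) (V : finType) (X : {set {ffun 'I_r.+1 -> V}}) (S : {set V}) :
  (#|X| <= #|edges_in X (fun=> S)| + r.+1 * (#|~: S| * #|V| ^ r))%N.
Proof.
rewrite -(cardsID (edges_in X (fun=> S)) X); apply: leq_add.
  by apply/subset_leq_card/subsetP => v; rewrite in_setI => /andP[].
apply: (@leq_trans #|\bigcup_(j : 'I_r.+1) [set v : {ffun 'I_r.+1 -> V} | v j \in ~: S]|).
  apply/subset_leq_card/subsetP => v; rewrite !inE => /andP[h vX].
  move: h; rewrite vX /= => /forallPn[j vj]; apply/bigcupP; exists j => //.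
  by rewrite !inE.
apply: (@leq_trans (\sum_(j : 'I_r.+1) #|[set v : {ffun 'I_r.+1 -> V} | v j \in ~: S]|)).
  elim/big_rec2: _ => [|j m Y _ IH]; first by rewrite cards0.
  by apply: leq_trans (leq_card_setU _ _) _; rewrite leq_add2l.
under eq_bigr do rewrite card_slab card_ord.
by rewrite sum_nat_const card_ord.
Qed.

Lemma exists_light_rich_tuple (R : archiRealFieldType) (r m D : nat) (eps : R) :
  0 < eps -> (0 < D)%N ->
  exists beta : R, exists n0 : nat, 0 < beta /\
  forall (V : finType) (H L : {set {set V}}) (w : V -> R) (theta : R),
    is_rgraph r.+1 H -> L \subset H -> (n0 <= #|V|)%N ->
    eps * (#|V| ^ r.+1)%:R <= #|L|%:R ->
    (forall e, e \in L -> \sum_(x in e) w x < theta) ->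
    exists a (B : 'I_r.+1 -> {set V}), [/\ beta * #|V|%:R <= a%:R,
      forall j, #|B j| = (D * a)%N,
      \sum_j \sum_(x in B j) w x <= theta * (D * a)%:R &
      path_rich H (m + r.+1) B a].
Proof.
move=> eps0 D0.
pose eta : R := (2 * (D.+1 ^ #|'I_r.+1|)%:R)^-1.
have eta0 : 0 < eta by rewrite invr_gt0 mulr_gt0 // ltr0n expn_gt0.
pose d := eps / 2; have d0 : 0 < d by rewrite divr_gt0.
have [h hh] : exists h, 1 < d * (1 + eta) ^+ h.
  have [h /(_ h (leqnn h)) hh] := exists_nat_bound ((d^-1) / eta).
  exists h; apply: lt_le_trans (_ : d * (1 + eta *+ h) <= _).
    rewrite -ltr_pdivrMl // mulr1 -mulr_natr; apply: (@lt_le_trans _ _ (eta * h%:R)); last by rewrite lerDr.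
    by rewrite mulrC -ltr_pdivrMr.
  rewrite ler_pM2l //; elim: h {hh} => [|h IH]; first by rewrite mulr0n addr0.
  rewrite exprS; apply: le_trans (_ : (1 + eta) * (1 + eta *+ h) <= _); last by rewrite ler_pM2l // addr_gt0.
  rewrite mulrDl mul1r mulrDr mulr1 mulrS -addrA lerD2l addrC lerD2l lerDl.
  by rewrite mulr_ge0 ?mulrn_wge0 // ltW.
pose q := (D.+1 ^ h)%N; have q0 : (0 < q)%N by rewrite expn_gt0.
pose beta : R := (2 * q%:R)^-1.
have beta0 : 0 < beta by rewrite invr_gt0 mulr_gt0 // ltr0n.
pose k := (m + r.+1)%N.
have [N1 hN1] := exists_nat_bound (2 * (r.+1 * q)%:R / eps).
have [N2 hN2] := exists_nat_bound (2 * (k * r.+1)%:R / (d * beta ^+ r.+1)).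
exists beta, (maxn q (maxn N1 N2)); split => // V H L w theta rH LH.
rewrite !geq_max => /and3P[nq n1 n2] cL wL.
set n := #|V| in nq n1 n2 cL *.
have n0 : (0 < n)%N := leq_trans q0 nq.
have rL : is_rgraph r.+1 L by move=> e eL; apply: rH; apply: (subsetP LH).
pose m0 := (n %/ q)%N.
have m00 : (0 < m0)%N by rewrite divn_gt0.
have m0n : beta * n%:R <= m0%:R.
  rewrite mulrC ler_pdivrMr ?mulr_gt0 ?ltr0n //.
  rewrite -!natrM ler_nat mulnCA mul2n -addnn {1}(divn_eq n q) leq_add2l.
  by rewrite (leq_trans (ltnW (ltn_pmod n q0))) // leq_pmull.
have qm : (q * m0 <= #|[set: V]|)%N by rewrite cardsT -/n mulnC leq_trunc_div.
have [S _ cS] := exists_subset_card qm.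
have cSC : (#|~: S| < q)%N.
  have := cardsC S; rewrite -/n cS [X in _ = X](divn_eq n q) -/m0 mulnC => /addnI ->.
  exact: ltn_pmod.
pose XL := ordered_edges r L; pose XH := ordered_edges r H.
have dS : d * ((q * m0) ^ #|'I_r.+1|)%:R <= #|edges_in XL (fun=> S)|%:R.
  have h1 : (#|L| <= #|edges_in XL (fun=> S)| + r.+1 * q * n ^ r)%N.
    apply: leq_trans (card_ordered_edges rL) _; apply: leq_trans (edges_in_setT_ge _ S) _.
    by rewrite leq_add2l -mulnA leq_mul2l /= leq_mul2r (ltnW cSC) orbT.
  have h2 : d * ((q * m0) ^ #|'I_r.+1|)%:R <= d * (n ^ r.+1)%:R.
    by rewrite ler_pM2l // ler_nat card_ord leq_exp2r // mulnC leq_trunc_div.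
  have h3 : (r.+1 * q * n ^ r)%:R <= d * (n ^ r.+1)%:R.
    have -> : (n ^ r.+1)%:R = n%:R * (n ^ r)%:R :> R by rewrite expnS natrM.
    rewrite [X in X <= _]natrM mulrA ler_wpM2r //.
    have := hN1 _ n1; rewrite ltr_pdivrMr // /d => h4.
    by apply/ltW; move: h4; set z := (r.+1 * q)%:R; set y := n%:R; lra.
  apply: le_trans h2 _; move: h1; rewrite -(ler_nat R) natrD => h1.
  have h5 : eps * (n ^ r.+1)%:R = d * (n ^ r.+1)%:R + d * (n ^ r.+1)%:R.
    by rewrite /d -mulrDl -splitr.
  rewrite h5 in cL; move: cL h1 h3; set x := d * _; set y := (#|L|)%:R; set z := (_ * _)%:R; set u := (_)%:R.
  by move=> *; lra.
have I0 : (0 < #|'I_r.+1|)%N by rewrite card_ord.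
have [a [A [m0a cA gA]]] := @exists_good_tuple _ _ R XL D m0 h d (fun=> S) D0 I0 m00 (ltW d0)
  (fun=> cS) dS hh.
have big : (k * (r.+1 * n ^ r))%:R < d / 2 * (m0 ^ #|'I_r.+1|)%:R.
  apply: (@lt_le_trans _ _ (d / 2 * (beta * n%:R) ^+ r.+1)); last first.
    rewrite ler_pM2l ?divr_gt0 // card_ord natrX; apply: lerXn2r; rewrite ?nnegrE //.
    by rewrite mulr_ge0 // ltW.
  rewrite mulnA natrM natrX exprMn [n%:R ^+ r.+1]exprS !mulrA ltr_pM2r ?exprn_gt0 ?ltr0n //.
  have db0 : 0 < d * beta ^+ r.+1 by apply: mulr_gt0 => //; apply: exprn_gt0.
  have := hN2 _ n2; rewrite ltr_pdivrMr //.
  set z := (k * _)%:R; set y := n%:R; set b := beta ^+ _ => h1.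
  by lra.
have /choice[s sP] : forall j, exists s : seq V, [/\ uniq s, size s = a, {subset s <= A j},
    sorted (fun x y => w y <= w x) s &
    forall x y, x \in s -> y \in A j -> y \notin s -> w y <= w x].
  by move=> j; apply: exists_top_set; rewrite cA leq_pmull.
pose T j := [set x in s j].
have cT j : #|T j| = a.
  by rewrite cardsE; have [/card_uniqP -> -> _ _ _] := sP j.
have TA j : T j \subset A j.
  by apply/subsetP => x; rewrite inE; have [_ _ h1 _ _] := sP j; apply: h1.
exists a; exists (fun j => A j :\: T j); split.
- by apply: le_trans m0n _; rewrite ler_nat.
- by move=> j; rewrite cardsDS // cA cT mulSn addKn.
- have : (0 < #|edges_in XL T|)%N.
    rewrite -(ltr0n R); apply: lt_le_trans (gA T TA cT).
    by apply: le_lt_trans big.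
  move=> /card_gt0P[v /edges_inP[vL vT]].
  have vi := ordered_edges_inj rL vL.
  move: vL; rewrite inE => /wL; rewrite big_imset /=; last by move=> i j _ _; apply: vi.
  under eq_bigl do rewrite inE.
  move=> wv; apply: (@le_trans _ _ (\sum_j w (v j) * (D * a)%:R)); last first.
    by rewrite -mulr_suml; apply: ler_wpM2r => //; apply: ltW.
  apply: ler_sum => j _; apply: (@le_trans _ _ (\sum_(x in A j :\: T j) w (v j))).
    apply: ler_sum => x; rewrite !inE => /andP[xT xA].
    have [_ _ _ _ top] := sP j; apply: top => //.
    by have := vT j; rewrite inE.
  by rewrite sumr_const cardsDS // cA cT mulSn addKn mulr_natr.
- move=> C CB aC.
  have /choice[Y YP] : forall j, exists Y : {set V}, Y \subset C j /\ #|Y| = a.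
    by move=> j; have [Y h1 h2] := exists_subset_card (aC j); exists Y.
  have YA j : Y j \subset A j.
    by apply: subset_trans (subset_trans (CB j) (subsetDl _ _)); case: (YP j).
  have cY j : #|Y j| = a by case: (YP j).
  have eY : (k * (r.+1 * n ^ r) < #|edges_in XH Y|)%N.
    rewrite -(ltr_nat R); apply: lt_le_trans big _; apply: le_trans (gA Y YA cY) _.
    rewrite ler_nat; apply/subset_leq_card/subsetP => v /edges_inP[vL vY].
    by apply/edges_inP; split => //; move: vL; rewrite !inE => /(subsetP LH).
  have [p [h1 h2 h3 h4]] := dense_box_path rH (leqnn k) eY.
  exists p; split => // x0 t tp.
  by have [/subsetP YC _] := YP (inZp t); apply: YC; apply: h3.
Qed.

(** * Fractional packing, rounding and tiling *)

Definition pos_part (R : realDomainType) (x : R) : R := Num.max 0 x.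

Lemma pos_part_ge0 (R : realDomainType) (x : R) : 0 <= pos_part x.
Proof. by rewrite /pos_part le_max lexx. Qed.

Lemma pos_partD_sqr_le (R : realDomainType) (x y : R) :
  pos_part (x + y) ^+ 2 <= (pos_part x + y) ^+ 2.
Proof.
rewrite /pos_part; case: (lerP 0 (x + y)) => h; last by rewrite expr0n sqr_ge0.
apply: lerXn2r; rewrite ?nnegrE //; last by rewrite lerD2r le_max lexx orbT.
by apply: le_trans h _; rewrite lerD2r le_max lexx orbT.
Qed.

(* Frank-Wolfe for fractional packing: always add lam times a test function on which
   the current excess load [pos_part (g - tau)] is small on average.  The square sum of
   the excess then grows only through second order terms. *)
Lemma greedy_fractional_packing (R : realFieldType) (V : finType) (Q : Type)
    (f : Q -> V -> R) (good : Q -> Prop) (c lam s b : R) (K : nat) :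
  (0 < #|V|)%N -> 0 < c -> 0 < lam ->
  (forall q v, good q -> 0 <= f q v <= s) ->
  (forall q, good q -> b <= \sum_v f q v) ->
  (forall w : V -> R, (forall v, 0 <= w v) -> exists2 q, good q &
     \sum_v w v * f q v <= (\sum_v f q v) / (c * #|V|%:R) * \sum_v w v) ->
  0 <= b -> c * #|V|%:R < lam * K%:R * b ->
  exists k (q : nat -> Q), let M := lam * \sum_(i < k) \sum_v f (q i) v in
    [/\ (k <= K)%N, forall i, (i < k)%N -> good (q i),
      c * #|V|%:R - lam * s * #|V|%:R <= M, M <= c * #|V|%:R &
      \sum_v pos_part (lam * (\sum_(i < k) f (q i) v) - 1) ^+ 2
        <= lam * s * (1 + (c ^+ 2)^-1) * M].
Proof.
move=> V0 c0 lam0 f0s fb oracle b0 bigK.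
set n : R := #|V|%:R in oracle bigK *.
have n0 : 0 < n by rewrite ltr0n.
have cn0 : 0 < c * n by rewrite mulr_gt0.
have [q0 gq0 _] : exists2 q, good q &
     \sum_v 0 * f q v <= (\sum_v f q v) / (c * n) * \sum_(v : V) 0 by apply: oracle.
pose mu q := \sum_v f q v.
pose M k (q : nat -> Q) := lam * \sum_(i < k) mu (q i).
pose g k (q : nat -> Q) v := lam * \sum_(i < k) f (q i) v.
pose S k q := \sum_v pos_part (g k q v - M k q / (c * n)) ^+ 2.
have mu_le q : good q -> mu q <= s * n.
  move=> gq; rewrite /mu; apply: (@le_trans _ _ (\sum_(v : V) s)).
    by apply: ler_sum => v _; have /andP[] := f0s q v gq.
  by rewrite sumr_const mulr_natr.
have mu_ge0 q : good q -> 0 <= mu q.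
  by move=> gq; apply: sumr_ge0 => v _; have /andP[] := f0s q v gq.
have main : exists k q, [/\ (k <= K)%N, forall i, (i < k)%N -> good (q i),
   M k q <= c * n, S k q <= lam * s * (1 + (c ^+ 2)^-1) * M k q &
   k = K \/ c * n - lam * s * n < M k q].
  clear bigK; elim: K => [|K' [k [q [kK gq Mc SM alt]]]].
    exists 0%N, (fun=> q0); split => //; last by left.
      by rewrite /M big_ord0 mulr0 ltW.
    rewrite /S /M /g big_ord0 !mulr0 mul0r big1 // => v _.
    by rewrite big_ord0 mulr0 subrr /pos_part maxxx expr0n.
  have [hM|hM] := ltP (c * n - lam * s * n) (M k q).
    by exists k, q; split => //; [apply: leqW | right].
  have {alt} kE : k = K' by case: alt => // /lt_geF; rewrite hM.
  pose w v := pos_part (g k q v - M k q / (c * n)).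
  have [p gp wp] := oracle w (fun v => pos_part_ge0 _).
  pose q' i := if i == k then p else q i.
  have sumq' (F : Q -> R) : \sum_(i < k.+1) F (q' i) = \sum_(i < k) F (q i) + F p.
    rewrite big_ord_recr /= {2}/q' eqxx; congr (_ + _); apply: eq_bigr => i _.
    by rewrite /q' ltn_eqF.
  have ME : M k.+1 q' = M k q + lam * mu p by rewrite /M sumq' mulrDr.
  have gE v : g k.+1 q' v = g k q v + lam * f p v.
    by rewrite /g (sumq' (fun q => f q v)) mulrDr.
  exists k.+1, q'; split.
  - by rewrite kE.
  - by move=> i; rewrite ltnS leq_eqVlt /q'; case: eqP => // _ /gq.
  - rewrite ME; have := mu_le _ gp; rewrite -(ler_pM2l lam0) mulrA => h.
    by move: h hM; set a := lam * mu p; set d := lam * s * n; lra.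
  - pose dt := lam * mu p / (c * n).
    have dt0 : 0 <= dt by rewrite /dt divr_ge0 ?(ltW cn0) // mulr_ge0 ?(ltW lam0) // mu_ge0.
    have step : S k.+1 q' <= S k q + \sum_v (2 * w v * (lam * f p v - dt) + ((lam * f p v) ^+ 2 + dt ^+ 2)).
      rewrite /S -big_split; apply: ler_sum => v _ /=.
      have -> : g k.+1 q' v - M k.+1 q' / (c * n) = (g k q v - M k q / (c * n)) + (lam * f p v - dt).
        by rewrite gE ME /dt (mulrDl (M k q)) opprD addrACA.
      apply: le_trans (pos_partD_sqr_le _ _) _; rewrite -/(w v).
      have /andP[fp0 _] := f0s p v gp.
      have : 0 <= lam * f p v * dt by rewrite mulr_ge0 // mulr_ge0 // ltW.
      set x := w v; set y := lam * f p v => xy.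
      have -> : (x + (y - dt)) ^+ 2 = x ^+ 2 + (2 * x * (y - dt) + (y ^+ 2 + dt ^+ 2)) - 2 * (y * dt) by ring.
      by rewrite lerBlDr lerDl mulr_ge0.
    have first : \sum_v 2 * w v * (lam * f p v - dt) <= 0.
      have -> : \sum_v 2 * w v * (lam * f p v - dt)
          = 2 * (lam * (\sum_v w v * f p v) - dt * \sum_v w v).
        rewrite mulr_sumr [dt * _]mulr_sumr -sumrB mulr_sumr; apply: eq_bigr => v _; ring.
      rewrite pmulr_rle0 // subr_le0 /dt -mulrA -mulrA ler_pM2l // mulrA.
      exact: wp.
    have second : \sum_v ((lam * f p v) ^+ 2 + dt ^+ 2) <= lam * s * (1 + (c ^+ 2)^-1) * (lam * mu p).
      rewrite big_split /= sumr_const -/n.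
      have h1 : \sum_v (lam * f p v) ^+ 2 <= lam * s * (lam * mu p).
        rewrite /mu !mulr_sumr; apply: ler_sum => v _; have /andP[h1 h2] := f0s p v gp.
        rewrite expr2; apply: ler_wpM2r; first by rewrite mulr_ge0 // ltW.
        by rewrite ler_pM2l.
      have h2 : dt ^+ 2 *+ #|V| <= lam * s * (c ^+ 2)^-1 * (lam * mu p).
        rewrite -mulr_natr -/n.
        have -> : dt ^+ 2 * n = lam * (mu p / n) * (c ^+ 2)^-1 * (lam * mu p).
          by rewrite /dt; field; rewrite gt_eqF // gt_eqF.
        apply: ler_wpM2r; first by rewrite mulr_ge0 ?(ltW lam0) // mu_ge0.
        apply: ler_wpM2r; first by rewrite invr_ge0 sqr_ge0.
        by rewrite ler_pM2l // ler_pdivrMr // mu_le.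
      by rewrite mulrDr mulr1 mulrDl lerD.
    rewrite ME mulrDr; apply: le_trans step _; rewrite big_split /=.
    by rewrite lerD // -[X in _ <= X]add0r lerD.
  - by left; rewrite kE.
have [k [q [kK gq Mc SM alt]]] := main; exists k, q; split => //.
  case: alt => [kE|]; last exact: ltW.
  suff : lam * K%:R * b <= M k q by move: Mc bigK => h1 h2 h3; have := lt_le_trans h2 (le_trans h3 h1); rewrite ltxx.
  rewrite /M -mulrA ler_pM2l // -kE mulr_natl -[k in _ *+ k]card_ord -sumr_const.
  by apply: ler_sum => i _; apply: fb; apply: gq.
apply: le_trans SM; apply: ler_sum => v _; apply: lerXn2r; rewrite ?nnegrE ?pos_part_ge0 //.
have : M k q / (c * n) <= 1 by rewrite ler_pdivrMr // mul1r.
rewrite /pos_part -/(g k q v) => h; rewrite ge_max le_max lexx /= le_max.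
by apply/orP; right; rewrite lerD2l lerN2.
Qed.

Lemma exists_assignment (I V : finType) (X : {set V}) (N : I -> nat) :
  (\sum_i N i <= #|X|)%N ->
  exists a : V -> option I, forall i, (N i <= #|[set x in X | a x == Some i]|)%N.
Proof.
rewrite -big_enum /=.
suff main : forall (s : seq I) (X : {set V}), uniq s -> (\sum_(i <- s) N i <= #|X|)%N ->
  exists a : V -> option I, forall i, i \in s -> (N i <= #|[set x in X | a x == Some i]|)%N.
  move=> h; have [a aP] := main _ _ (enum_uniq I) h.
  by exists a => i; apply: aP; rewrite mem_enum.
elim=> [|j s IH] {}X /=; first by move=> _ _; exists (fun=> None).
rewrite big_cons => /andP[js us] h.
have [Y YX cY] : exists2 Y : {set V}, Y \subset X & #|Y| = N j.
  by apply: exists_subset_card; apply: leq_trans h; apply: leq_addr.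
have [|a aP] := IH (X :\: Y) us; first by rewrite cardsDS // cY leq_subRL // (leq_trans _ h) // leq_addr.
exists (fun x => if x \in Y then Some j else a x) => i; rewrite inE => /orP[/eqP ->|hi].
  rewrite -cY; apply/subset_leq_card/subsetP => x xY.
  by rewrite !inE xY (subsetP YX) //= eqxx.
apply: leq_trans (aP i hi) _; apply/subset_leq_card/subsetP => x; rewrite !inE.
by move=> /andP[/andP[/negbTE -> ->]].
Qed.

(* Vertices lying in the same sets B i form an atom; each atom is split according to
   the fractional loads, at the cost of one vertex per atom. *)
Lemma round_fractional_packing (R : archiRealFieldType) (I V : finType)
    (B : I -> {set V}) (lam : R) :
  0 < lam ->
  exists a : V -> option I, forall i,
    lam * #|B i|%:R - lam * (\sum_(v in B i) pos_part (lam * #|[set i | v \in B i]|%:R - 1))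
      - #|{set I}|%:R <= #|[set v in B i | a v == Some i]|%:R.
Proof.
move=> lam0.
pose pat v : {set I} := [set i | v \in B i].
pose y (P : {set I}) : R := lam / Num.max 1 (lam * #|P|%:R).
have max0 P : 0 < Num.max 1 (lam * #|P : {set I}|%:R) by rewrite lt_max ltr01.
pose N (P : {set I}) i : nat := if i \in P then Num.truncn (y P * #|[set v | pat v == P]|%:R) else 0.
have y0 P : 0 <= y P by apply: divr_ge0; apply: ltW.
have /choice[a aP] : forall P : {set I}, exists a : V -> option I, forall i,
    (N P i <= #|[set x in [set v | pat v == P] | a x == Some i]|)%N.
  move=> P; apply: exists_assignment; set m := #|_|.
  rewrite -(@ler_nat R) natr_sum; apply: (@le_trans _ _ (\sum_(i in P) y P * m%:R)).
    rewrite [X in _ <= X]big_mkcond; apply: ler_sum => i _; rewrite /N; case: ifP => // _.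
    by rewrite truncn_le mulr_ge0.
  rewrite sumr_const -[X in X <= _]mulr_natr mulrAC; apply: ler_piMl => //.
  by rewrite /y mulrAC ler_pdivrMr // mul1r le_max lexx orbT.
exists (fun v => a (pat v) v) => i.
rewrite -mulrBr.
have -> : #|B i|%:R - \sum_(v in B i) pos_part (lam * #|[set i | v \in B i]|%:R - 1)
    = \sum_(v in B i) (1 - pos_part (lam * #|pat v|%:R - 1)).
  by rewrite sumrB sumr_const.
have -> : #|{set I}|%:R = \sum_(P : {set I}) 1 :> R by rewrite sumr_const.
rewrite mulr_sumr (partition_big pat predT) //= -sumrB.
rewrite -[X in _ <= X%:R]sum1_card natr_sum [X in _ <= X](partition_big pat predT) //=.
apply: ler_sum => P _.
rewrite -natr_sum sum1_card.
have [iP|iP] := boolP (i \in P); last first.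
  rewrite big_pred0 ?sub0r; last first.
    move=> v; apply/negP => /andP[vB /eqP vP]; move: iP; rewrite -vP inE vB //.
  by rewrite (le_trans _ (ler0n _ _)) // oppr_le0 ler01.
have inB v : pat v == P -> v \in B i by move=> /eqP vP; move: iP; rewrite -vP inE.
have -> : \sum_(v in B i | pat v == P) lam * (1 - pos_part (lam * #|pat v|%:R - 1))
    = lam * (1 - pos_part (lam * #|P|%:R - 1)) * #|[set v | pat v == P]|%:R.
  rewrite -[X in _ = _ * X%:R]sum1_card natr_sum mulr_sumr; apply: eq_big => [v|v /andP[_ /eqP ->]]; last by rewrite mulr1.
  by rewrite inE; case: (boolP (pat v == P)) => [/inB ->|_]; rewrite ?andbF.
have := aP P i; rewrite /N iP -(@ler_nat R) => h.
have -> : #|[pred v | (v \in [set v in B i | a (pat v) v == Some i]) && (pat v == P)]|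
   = #|[set x in [set v | pat v == P] | a P x == Some i]|.
  apply: eq_card => v; rewrite !inE.
  case: (boolP (pat v == P)) => [vP|]; rewrite ?andbF //= andbT.
  by rewrite (inB v vP) (eqP vP).
apply: le_trans h; rewrite lerBlDr.
set m := #|[set v | pat v == P]|%:R.
apply: (@le_trans _ _ (y P * m)); last first.
  by have := truncnS_gt (y P * m); rewrite -addn1 natrD => /ltW.
apply: ler_wpM2r => //; rewrite /y ler_pM2l // -[X in _ <= X]mul1r ler_pdivlMr //.
rewrite /pos_part; set t := lam * _.
case: (lerP 1 t) => ht; last by rewrite max_l ?subr0 ?mulr1 // subr_le0 ltW.
rewrite max_r ?subr_ge0 //.
have : 0 <= (t - 1) ^+ 2 by apply: sqr_ge0.
rewrite expr2; lra.
Qed.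

Local Open Scope nat_scope.

Lemma card_part_cyclic_path (r l : nat) (V : finType) (C : 'I_r.+1 -> {set V}) (p : seq V) j :
  (forall i i' x, x \in C i -> x \in C i' -> i = i') ->
  size p = l * r.+1 ->
  (forall x0 s, s < size p -> nth x0 p s \in C (inZp s)) ->
  #|[set x in C j | x \in p]| <= l.
Proof.
move=> Cdis sp pC.
have idx x : x \in [set x in C j | x \in p] -> index x p < size p /\ index x p %% r.+1 = j.
  rewrite inE => /andP[xC xp]; have ip : index x p < size p by rewrite index_mem.
  split => //; have := pC x _ ip; rewrite nth_index // => /(Cdis _ _ _ xC) ->; by [].
case: l sp => [|l] sp.
  rewrite leqn0 cards_eq0; apply/eqP/setP => x; rewrite [RHS]inE; apply/negP => /idx[].
  by rewrite sp mul0n.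
pose F x : 'I_l.+1 := inord (index x p %/ r.+1).
rewrite -(@card_in_imset _ _ F); first by apply: leq_trans (max_card _) _; rewrite card_ord.
move=> x y /idx[x1 x2] /idx[y1 y2] /(congr1 val) /=.
have hF z : index z p < size p -> index z p %/ r.+1 < l.+1 by rewrite ltn_divLR // sp.
rewrite !inordK ?hF // => E.
have : index x p = index y p by rewrite (divn_eq (index x p) r.+1) (divn_eq (index y p) r.+1) E x2 y2.
have [xp yp] : x \in p /\ y \in p by rewrite -!index_mem.
by move=> E2; rewrite -(nth_index x xp) E2 nth_index.
Qed.

Lemma tile_rich_tuple (r l : nat) (V : finType) (H : {set {set V}})
    (B C : 'I_r.+1 -> {set V}) (a : nat) :
  path_rich H (l.+1 * r.+1) B a -> (forall j, C j \subset B j) ->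
  (forall i i' x, x \in C i -> x \in C i' -> i = i') ->
  exists ss : seq (seq V), [/\
    forall p, p \in ss -> [/\ size p = l.+1 * r.+1, {subset windows r.+1 p <= H} &
      forall x, x \in p -> exists j, x \in C j],
    uniq (flatten ss) & exists j, #|C j| < a + size ss * l.+1].
Proof.
move=> rich; move: {2}#|C ord0| (leqnn #|C ord0|) => N.
elim: N C => [|N IH] C CN CB Cdis.
  have [a0|a0] := posnP a; last by exists [::]; split => //; exists ord0; rewrite mul0n addn0 (leq_ltn_trans CN).
  have [|p [sp _ pC _]] := rich C CB; first by rewrite a0.
  have x0 : V by case: p sp {pC}.
  have := pC x0 0; rewrite sp muln_gt0 /= => /(_ isT) h.
  by move: CN; rewrite leqNgt card_gt0; case/negP; apply/set0Pn; exists (nth x0 p 0); rewrite (_ : ord0 = inZp 0) //; apply: val_inj; rewrite /= mod0n.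
have [[j jC]|big] := pselect (exists j, #|C j| < a).
  by exists [::]; split => //; exists j; rewrite addn0.
have aC j : a <= #|C j| by rewrite leqNgt; apply/negP => h; apply: big; exists j.
have [p [sp up pC pH]] := rich C CB aC.
pose C' j := [set x in C j | x \notin p].
have C'C j : C' j \subset C j by apply/subsetP => x; rewrite inE => /andP[].
have p0 : 0 < size p by rewrite sp muln_gt0.
have C'N : #|C' ord0| <= N.
  rewrite -ltnS; apply: leq_trans CN; apply: proper_card; apply/properP; split => //.
  have x0 : V by case: (p) p0.
  exists (nth x0 p 0).
    by have := pC x0 _ p0; rewrite (_ : inZp 0 = ord0 :> 'I_r.+1) //; apply: val_inj; rewrite /= mod0n.
  by rewrite inE mem_nth // andbF.
have [||ss [ssP uss [j jss]]] := IH C' C'N.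
- by move=> j; apply: subset_trans (C'C j) (CB j).
- by move=> i i' x /(subsetP (C'C _)) h /(subsetP (C'C _)); apply: Cdis.
exists (p :: ss); split.
- move=> s; rewrite inE => /orP[/eqP ->|/ssP[h1 h2 h3]].
    split => // x xp; exists (inZp (index x p)).
    by have := pC x (index x p); rewrite nth_index // => -> //; rewrite index_mem.
  by split => // x /h3[i xi]; exists i; apply: (subsetP (C'C i)).
- rewrite /= cat_uniq up uss andbT /=; apply/hasPn => x /flattenP[s /ssP[_ _ h] /h[i]].
  by rewrite inE => /andP[].
- exists j; rewrite /= mulSn addnCA.
  have -> : #|C j| = #|[set x in C j | x \in p]| + #|C' j|.
    rewrite -(cardsID [set x in p] (C j)); congr (_ + _); apply: eq_card => x; rewrite !inE //.
    by rewrite andbC.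
  by rewrite -addnS leq_add // (card_part_cyclic_path _ Cdis sp pC).
Qed.

Lemma uniq_flatten_indexed (I V : eqType) (s : seq I) (SS : I -> seq (seq V)) (D : I -> V -> Prop) :
  uniq s -> (forall i, uniq (flatten (SS i))) ->
  (forall i p x, p \in SS i -> x \in p -> D i x) ->
  (forall i i' x, D i x -> D i' x -> i = i') ->
  uniq (flatten (flatten [seq SS i | i <- s])).
Proof.
move=> us uSS SSD Ddis; elim: s us => //= i s IH /andP[iss us].
rewrite flatten_cat cat_uniq uSS IH // andbT /=; apply/hasPn => x.
case/flattenP => p /flattenP[_ /mapP[i' i's ->] pi'] xp; apply/negP => /flattenP[p' pi xp'].
by move: iss; rewrite (Ddis i i' x) ?i's //; [apply: SSD pi xp'|apply: SSD pi' xp].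
Qed.

Local Open Scope ring_scope.

Lemma exists_small_factor (R : archiRealFieldType) (x y : R) :
  0 < y -> exists l : nat, x / l.+1%:R <= y.
Proof.
move=> y0; have [N /(_ N.+1 (leqnSn N)) hN] := exists_nat_bound (x / y).
by exists N; rewrite ler_pdivrMr // mulrC -ler_pdivrMr // ltW.
Qed.

Lemma sqr_sub_div (F : numFieldType) (x d : F) : d != 0 ->
  (x - 2 * d) ^+ 2 / (4 * d) = (4 * d)^-1 * x ^+ 2 + d - x.
Proof. by move=> d0; field. Qed.

(* The hypothesis on light edges supplies the oracle of [greedy_fractional_packing] with
   rich tuples; after rounding, each tuple keeps about a lam-fraction of its vertices, and
   this fraction is tiled by tight paths of bounded length. *)
Lemma exists_tight_packing (R : archiRealFieldType) (r : nat) (c c1 eps : R) :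
  0 < c -> c < c1 -> c1 <= 1 -> 0 < eps ->
  exists n0 : nat, forall (V : finType) (H : {set {set V}}),
    (n0 <= #|V|)%N -> is_rgraph r.+1 H ->
    (forall (w : V -> R) (theta : R), (forall v, 0 <= w v) -> 0 < theta ->
       \sum_v w v <= c1 / r.+1%:R * theta * #|V|%:R ->
       eps * (#|V| ^ r.+1)%:R <= #|[set e in H | \sum_(x in e) w x < theta]|%:R) ->
    exists ss, tight_packing r.+1 H ss /\
      c * #|V|%:R <= (\sum_(s <- ss) ((size s).+1 - r.+1))%:R.
Proof.
move=> c0 cc1 c11 eps0.
set rho : R := r.+1%:R; have rho0 : 0 < rho by rewrite ltr0n.
have rhoN := ltW rho0.
have rho1 : 1 <= rho by rewrite ler1n.
have c10 : 0 < c1 by apply: lt_trans cc1.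
pose z := (c1 - c) / 8; have z0 : 0 < z by rewrite divr_gt0 // subr_gt0.
have [l hl] := @exists_small_factor R 1 z z0.
pose delta := z / (2 * rho); have delta0 : 0 < delta by rewrite divr_gt0 // mulr_gt0.
pose K0 : R := rho * (1 + (c1 ^+ 2)^-1).
pose K1 : R := 1 + (4 * delta)^-1.
have K00 : 0 < K0 by rewrite mulr_gt0 // addr_gt0 // invr_gt0 exprn_gt0.
have K10 : 0 < K1 by rewrite addr_gt0 // invr_gt0 mulr_gt0.
have K0N := ltW K00; have K1N := ltW K10.
have [l1 hl1] := @exists_small_factor R (2 * rho * K1 * K0 + rho) z z0.
pose lam : R := l1.+1%:R^-1; have lam0 : 0 < lam by rewrite invr_gt0.
have lamN := ltW lam0.
have lam_rho : lam * rho <= z.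
  apply: le_trans hl1; rewrite /lam mulrC ler_pM2r ?invr_gt0 // lerDr. by do ?[apply: mulr_ge0 => //].
have lam_K : 2 * rho * K1 * (lam * K0) <= z.
  apply: le_trans hl1; rewrite /lam [_^-1 * K0]mulrC mulrA ler_pM2r ?invr_gt0 // lerDl.
  exact: ltW.
have [D1 hD] := @exists_small_factor R (lam^-1) z z0.
pose D := D1.+1.
have [beta [n1 [beta0 rich]]] := @exists_light_rich_tuple R r (l * r.+1) D eps eps0 isT.
pose b0 := rho * D%:R * beta; have b00 : 0 < b0 by rewrite !mulr_gt0 // ltr0n.
have [K /(_ K (leqnn K)) hK] := exists_nat_bound (c1 / (lam * b0)).
pose P : R := (2 ^ (K * r.+1))%:R.
have P0 : 0 <= P by [].
have [n2 hn2] := exists_nat_bound (rho * K%:R * P / z).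
exists (maxn 1 (maxn n1 n2)) => V H; rewrite !geq_max => /and3P[n_gt0 nn1 nn2] rH light.
set n : R := #|V|%:R in light *; have n0 : 0 < n by rewrite ltr0n.
pose Q : Type := (nat * ('I_r.+1 -> {set V}))%type.
pose good (q : Q) := [/\ beta * n <= q.1%:R, forall j, #|q.2 j| = (D * q.1)%N &
   path_rich H (l.+1 * r.+1) q.2 q.1].
pose f (q : Q) v : R := (\sum_j (v \in q.2 j))%:R.
have sumwf (w : V -> R) q : \sum_v w v * f q v = \sum_j \sum_(x in q.2 j) w x.
  rewrite [RHS](eq_bigr (fun j => \sum_v (v \in q.2 j)%:R * w v)); last first.
    by move=> j _; rewrite big_mkcond; apply: eq_bigr => v _; case: (v \in _); rewrite ?mul1r ?mul0r.
  by rewrite exchange_big; apply: eq_bigr => v _ /=; rewrite -mulr_suml -natr_sum mulrC.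
have mu_good q : good q -> \sum_v f q v = rho * D%:R * q.1%:R.
  move=> [_ cq _]; have := sumwf (fun=> 1) q; under eq_bigr do rewrite mul1r; move=> ->.
  under eq_bigr do rewrite sumr_const cq.
  by rewrite sumr_const card_ord -[LHS]mulr_natl natrM mulrA.
have f_le q v : good q -> 0 <= f q v <= rho.
  move=> _; rewrite /f ler0n /= ler_nat.
  apply: (@leq_trans (\sum_(j : 'I_r.+1) 1)%N); first by apply: leq_sum => j _; case: (_ \in _).
  by rewrite sum1_card card_ord.
have b_le q : good q -> b0 * n <= \sum_v f q v.
  move=> gq; rewrite (mu_good _ gq); have [h _ _] := gq.
  by rewrite /b0 -[in X in X <= _]mulrA ler_pM2l // mulr_gt0 // ltr0n.
have get (w : V -> R) theta : (forall v, 0 <= w v) -> 0 < theta ->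
    \sum_v w v <= c1 / rho * theta * n ->
    exists2 q, good q & \sum_v w v * f q v <= theta * (D * q.1)%:R.
  move=> w0 th0 /(light _ _ w0 th0) hL.
  have [||a [B [h1 h2 h3 h4]]] := rich V H _ w theta rH _ nn1 hL.
  - by apply/subsetP => e; rewrite inE => /andP[].
  - by move=> e; rewrite inE => /andP[].
  exists (a, B); last by rewrite sumwf.
  by split => //=; rewrite mulSn addnC.
have oracle (w : V -> R) : (forall v, 0 <= w v) -> exists2 q, good q &
     \sum_v w v * f q v <= (\sum_v f q v) / (c1 * n) * \sum_v w v.
  move=> w0; have W0 : 0 <= \sum_v w v by apply: sumr_ge0.
  have [Wpos|] := ltP 0 (\sum_v w v).
    have [||q gq hq] := get w ((\sum_v w v) * rho / (c1 * n)) w0.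
    - by rewrite divr_gt0 // mulr_gt0.
    - by rewrite le_eqVlt; apply/orP; left; apply/eqP; field; rewrite nat1r !pnatr_eq0 -lt0n n_gt0 (gt_eqF c10).
    exists q => //; apply: le_trans hq _; rewrite (mu_good _ gq) le_eqVlt; apply/orP; left; apply/eqP.
    by rewrite natrM; field; rewrite pnatr_eq0 -lt0n n_gt0 (gt_eqF c10).
  move=> Wneg; have WE : \sum_v w v = 0 by apply/eqP; rewrite eq_le Wneg W0.
  have [|q gq hq] := get w 1 w0 ltr01; first by (rewrite WE; do ?[apply: mulr_ge0 => //]; rewrite ?invr_ge0 // ltW).
  exists q => //; rewrite WE mulr0 big1 // => v _.
  by move/eqP: WE; rewrite psumr_eq0 // => /allP/(_ v); rewrite mem_index_enum => /(_ isT)/eqP ->; rewrite mul0r.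
have bK : c1 * n < lam * K%:R * (b0 * n).
  rewrite mulrA ltr_pM2r //; move: hK; rewrite ltr_pdivrMr ?mulr_gt0 //.
  by rewrite mulrA (mulrC K%:R).
have bn0 : 0 <= b0 * n by rewrite mulr_ge0 // ltW.
have [k [q /=]] := greedy_fractional_packing n_gt0 c10 lam0 f_le b_le oracle bn0 bK.
set M := lam * (\sum_(i < k) \sum_v _) => -[kK gq Mlo Mhi Sle].
pose I := ('I_k * 'I_r.+1)%type.
pose B (i : I) : {set V} := (q i.1).2 i.2.
pose g v : R := lam * #|[set i : I | v \in B i]|%:R.
have gE v : g v = lam * (\sum_(i < k) f (q i) v).
  rewrite /g /f -natr_sum pair_big /= -sum1_card big_mkcond /=; congr (_ * _%:R).
  by apply: eq_bigr => i _; rewrite inE /B; case: (_ \in _).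
have [a aP] := @round_fractional_packing R I V B lam lam0.
pose loss (i : I) := lam * (\sum_(v in B i) pos_part (g v - 1)).
have loss0 i : 0 <= loss i by rewrite mulr_ge0 ?(ltW lam0) // sumr_ge0 // => v _; apply: pos_part_ge0.
have total_loss : rho * \sum_i loss i <= z * n.
  have -> : \sum_i loss i = \sum_v g v * pos_part (g v - 1).
    rewrite /loss -mulr_sumr (eq_bigr (fun i : I => \sum_v (v \in B i)%:R * pos_part (g v - 1))); last first.
      by move=> i _; rewrite big_mkcond; apply: eq_bigr => v _; case: (v \in _); rewrite ?mul1r ?mul0r.
    rewrite exchange_big mulr_sumr /=; apply: eq_bigr => v _.
    rewrite -mulr_suml mulrA /g; congr (_ * _ * _).
    rewrite -natr_sum; congr (_%:R); rewrite -sum1_card [RHS]big_mkcond; apply: eq_bigr => i _.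
    by rewrite inE; case: (_ \in _).
  have pt v : g v * pos_part (g v - 1) <= delta + K1 * pos_part (g v - 1) ^+ 2.
    have -> : g v * pos_part (g v - 1) = pos_part (g v - 1) + pos_part (g v - 1) ^+ 2.
      rewrite /pos_part; case: (lerP (g v - 1) 0) => h; first by ring.
      by ring.
    set x := pos_part _; rewrite /K1 mulrDl mul1r addrCA [X in _ <= X]addrC lerD2r.
    have : 0 <= (x - 2 * delta) ^+ 2 / (4 * delta) by rewrite divr_ge0 ?sqr_ge0 // mulr_ge0 // ltW.
    have -> : (x - 2 * delta) ^+ 2 / (4 * delta) = (4 * delta)^-1 * x ^+ 2 + delta - x.
      by apply: sqr_sub_div; rewrite gt_eqF.
    by rewrite subr_ge0 addrC.
  have S2 : \sum_v pos_part (g v - 1) ^+ 2 <= lam * K0 * n.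
    under eq_bigr do rewrite gE.
    apply: le_trans Sle _; rewrite /K0 (mulrA lam rho); apply: ler_wpM2l.
      by do ?[apply: mulr_ge0 => //]; rewrite addr_ge0 // invr_ge0 sqr_ge0.
    by apply: le_trans Mhi _; rewrite ger_pMl.
  have S3 : \sum_v g v * pos_part (g v - 1) <= delta * n + K1 * (lam * K0 * n).
    apply: (@le_trans _ _ (\sum_v (delta + K1 * pos_part (g v - 1) ^+ 2))); first exact: ler_sum.
    rewrite big_split /= sumr_const -mulr_sumr -/n -[delta *+ _]mulr_natr lerD2l.
    by rewrite ler_pM2l.
  apply: le_trans (ler_wpM2l (ltW rho0) S3) _.
  have -> : rho * (delta * n + K1 * (lam * K0 * n)) = (2 * rho * delta + 2 * rho * K1 * (lam * K0)) / 2 * n.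
    by field.
  rewrite ler_pM2r // ler_pdivrMr // [X in _ <= X]mulr_natr mulr2n lerD // /delta mulrC divfK //.
  by rewrite gt_eqF // mulr_gt0.
pose C (i : 'I_k) (j : 'I_r.+1) : {set V} := [set v in B (i, j) | a v == Some (i, j)].
have CB i j : C i j \subset (q i).2 j by apply/subsetP => v; rewrite inE => /andP[].
have Cdis i i' j j' x : x \in C i j -> x \in C i' j' -> (i, j) = (i', j').
  by rewrite !inE => /andP[_ /eqP ->] /andP[_ /eqP []] -> ->.
have /choice[SS SSP] : forall i : 'I_k, exists ss : seq (seq V), [/\
    forall p, p \in ss -> [/\ size p = (l.+1 * r.+1)%N, {subset windows r.+1 p <= H} &
      forall x, x \in p -> exists j, x \in C i j],
    uniq (flatten ss) & exists j, (#|C i j| < (q i).1 + size ss * l.+1)%N].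
  move=> i; have [_ _ qr] := gq i (ltn_ord i).
  by apply: tile_rich_tuple qr (CB i) _ => j j' x h1 h2; case: (Cdis _ _ _ _ _ h1 h2).
have count (i : 'I_k) : lam * D%:R * (q i).1%:R - \sum_j loss (i, j) - P - (q i).1%:R <= (size (SS i))%:R * l.+1%:R.
  have [_ _ [j hj]] := SSP i; have [_ cq _] := gq i (ltn_ord i).
  have h1 : lam * D%:R * (q i).1%:R - loss (i, j) - P <= #|C i j|%:R.
    apply: le_trans (aP (i, j)); rewrite lerD ?lerN2 //.
      by rewrite lerD ?lerN2 // /B /= cq natrM mulrA.
    have -> : #|{set I}| = (2 ^ (k * r.+1))%N.
      by rewrite -cardsT -powersetT card_powerset cardsT card_prod !card_ord.
    by rewrite ler_nat leq_exp2l // leq_mul2r kK orbT.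
  have h2 : loss (i, j) <= \sum_j loss (i, j).
    by rewrite (bigD1 j) //= lerDl sumr_ge0.
  have h3 : #|C i j|%:R <= (q i).1%:R + (size (SS i))%:R * l.+1%:R :> R.
    by rewrite -natrM -natrD ler_nat ltnW.
  move: h1 h2 h3; set x1 := lam * _ * _; set x2 := loss _; set x3 := #|_|%:R; set x4 := \sum_j _.
  set x5 := (q i).1%:R; set x6 := _ * l.+1%:R; clear; by lra.
have MD : M = \sum_(i < k) rho * (lam * D%:R * (q i).1%:R).
  rewrite /M mulr_sumr; apply: eq_bigr => i _; rewrite (mu_good _ (gq i (ltn_ord i))); ring.
have Md : \sum_(i < k) rho * (q i).1%:R <= z * n.
  have -> : \sum_(i < k) rho * (q i).1%:R = lam^-1 / D%:R * M.
    rewrite MD mulr_sumr; apply: eq_bigr => i _.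
    have -> : rho * (lam * D%:R * (q i).1%:R) = lam * D%:R * (rho * (q i).1%:R) by ring.
    have lD : lam * D%:R != 0 by rewrite gt_eqF // mulr_gt0 // ltr0n.
    by rewrite -invfM [RHS]mulrA mulVf // mul1r.
  apply: ler_pM => //; first by rewrite divr_ge0 // invr_ge0 ltW.
    by rewrite MD sumr_ge0 // => i _; do ?[apply: mulr_ge0 => //].
  by apply: le_trans Mhi _; rewrite ger_pMl.
pose Y : R := \sum_(i < k) rho * ((size (SS i))%:R * l.+1%:R).
have Yge : (c1 - 4 * z) * n <= Y.
  have h1 : M - rho * (\sum_i loss i) - rho * K%:R * P - \sum_(i < k) rho * (q i).1%:R <= Y.
    have -> : \sum_i loss i = \sum_(i < k) \sum_j loss (i, j) by rewrite pair_big; apply: eq_bigr => -[].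
    apply: (@le_trans _ _ (\sum_(i < k) rho * (lam * D%:R * (q i).1%:R - \sum_j loss (i, j) - P - (q i).1%:R))); last first.
      by apply: ler_sum => i _; rewrite ler_pM2l // count.
    under [X in _ <= X]eq_bigr do rewrite !mulrBr.
    rewrite !sumrB -MD lerD2r -mulr_sumr lerD2l lerN2 sumr_const card_ord.
    rewrite -[X in X <= _]mulr_natr -[X in X <= _]mulrA -[X in _ <= X]mulrA ler_pM2l // mulrC.
    by apply: ler_wpM2r => //; rewrite ler_nat.
  have h2 : rho * K%:R * P <= z * n.
    by have := hn2 _ nn2; rewrite ltr_pdivrMr // [X in _ < X]mulrC => /ltW.
  have h3 : lam * rho * n <= z * n by rewrite ler_pM2r.
  rewrite mulrBl -mulrA.
  move: h1 h2 h3 Mlo total_loss Md; clear; set x0 := z * n; set x1 := rho * \sum_i _.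
  set x2 := rho * _ * _; set x3 := lam * _ * _.
  by move: (\sum_(i < k) _) (c1 * n) => x4 x5; lra.
exists (flatten [seq SS i | i <- enum 'I_k]); split.
  split.
    apply: (@uniq_flatten_indexed _ _ _ _ (fun i x => exists j, x \in C i j)); first exact: enum_uniq.
    - by move=> i; case: (SSP i).
    - by move=> i p x pi xp; have [/(_ p pi)[_ _ h] _ _] := SSP i; apply: h.
    - by move=> i i' x [j h1] [j' h2]; case: (Cdis _ _ _ _ _ h1 h2).
  by move=> s /flattenP[_ /mapP[i _ ->] si]; have [/(_ s si)[_ h _] _ _] := SSP i.
have -> : (\sum_(s <- flatten [seq SS i | i <- enum 'I_k]) ((size s).+1 - r.+1)
     = \sum_(i < k) size (SS i) * (l * r.+1).+1)%N.
  rewrite big_flatten big_map big_enum /=; apply: eq_bigr => i _.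
  rewrite big_seq (eq_bigr (fun=> (l * r.+1).+1)); last first.
    by move=> s si; have [/(_ s si)[-> _ _] _ _] := SSP i; rewrite mulSn -addnS addKn.
  by rewrite -big_seq big_const_seq count_predT iter_addn_0 mulnC.
apply: (@le_trans _ _ (Y * (1 - 1 / l.+1%:R))).
  apply: (@le_trans _ _ ((c1 - 4 * z) * n * (1 - z))).
    have -> : c = c1 - 8 * z by rewrite /z; field.
    rewrite mulrAC ler_pM2r //.
    have : 0 <= z * (3 - c1 + 4 * z).
      by rewrite mulr_ge0 // ?(ltW z0) //; move: c11 z0; clear; lra.
    rewrite -subr_ge0 => h.
    have -> : (c1 - 4 * z) * (1 - z) - (c1 - 8 * z) = z * (3 - c1 + 4 * z) + z by ring.
    by rewrite addr_ge0 // ltW.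
  have Y0 : 0 <= Y by apply: sumr_ge0 => i _; do ?[apply: mulr_ge0 => //].
  have z1 : 0 <= 1 - z by rewrite /z; move: c0 c11 cc1; clear; lra.
  apply: (@le_trans _ _ (Y * (1 - z))); first exact: ler_wpM2r.
  by apply: ler_wpM2l => //; rewrite lerD2l lerN2.
rewrite /Y mulr_suml natr_sum; apply: ler_sum => i _.
have -> : rho * ((size (SS i))%:R * l.+1%:R) * (1 - 1 / l.+1%:R) = (size (SS i))%:R * (l%:R * rho).
  have -> : l%:R = l.+1%:R - 1 :> R by rewrite -addn1 natrD addrK.
  by field; rewrite ?nat1r ?pnatr_eq0.
by rewrite -!natrM ler_nat leq_mul2l leqnSn orbT.
Qed.

(** * Asymptotics *)

Lemma leq_expn (m n e : nat) : (m <= n)%N -> (m ^ e <= n ^ e)%N.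
Proof. by case: e => // e mn; rewrite leq_exp2r. Qed.

Lemma bin_le_expn (n m : nat) : ('C(n, m) <= n ^ m)%N.
Proof.
elim: n m => [|n IH] [|m]; rewrite ?bin0 // binS.
apply: leq_trans (leq_add (IH m.+1) (IH m)) _.
by rewrite expnS addnC -mulSn expnS leq_mul2l leq_expn ?orbT.
Qed.

Lemma bin_sub_le (n a b r : nat) :
  ('C(n - a, r.+1) <= 'C(n - b, r.+1) + (b - a) * n ^ r)%N.
Proof.
have [d [dab dn le]] : exists d, [/\ (d <= b - a)%N, (n - b + d <= n)%N & (n - a <= n - b + d)%N].
  by exists ((n - a) - (n - b))%N; split; lia.
apply: leq_trans (leq_bin2l _ le) _.
apply: (@leq_trans ('C(n - b, r.+1) + d * n ^ r)); last by rewrite leq_add2l leq_mul2r dab orbT.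
move: dn; clear dab le; elim: d => [|d IH] dn; first by rewrite addn0 mul0n addn0.
rewrite addnS binS mulSn addnCA addnC leq_add //; last by apply: IH; lia.
by apply: leq_trans (bin_le_expn _ _) _; apply: leq_expn; lia.
Qed.

Lemma turan_lower (R : archiRealFieldType) (r : nat) (c : R) (n : nat) :
  (0 < r)%N -> 0 < c -> c <= 1 ->
  ('C(n, r) <= turan_number r n (tight_linear_forests r n (Num.truncn (c * n%:R)%R))
     + 'C(n - (Num.truncn (c * n%:R / r%:R)%R).-1, r))%N.
Proof.
move=> r0 c0 c1; set q := Num.truncn (c * n%:R / r%:R); set k := Num.truncn (c * n%:R).
have cn0 : 0 <= c * n%:R by rewrite mulr_ge0 // ltW.
have [q0|q0] := posnP q; first by rewrite q0 subn0 leq_addl.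
have qk : (r * q <= k)%N.
  rewrite truncn_ge_nat // natrM mulrC -ler_pdivlMr ?ltr0n //.
  by rewrite /q truncn_le divr_ge0.
have qn : (q.-1 <= #|[set: 'I_n]|)%N.
  rewrite cardsT card_ord (leq_trans (leq_pred _)) // (leq_trans (_ : q <= k)%N) //.
    by apply: leq_trans qk; rewrite leq_pmull.
  rewrite -(@ler_nat R) (le_trans (_ : _ <= c * n%:R)) ?truncn_le //.
  exact: ler_piMl.
have [A _ cA] := exists_subset_card qn.
pose H : {set {set 'I_n}} := [set e : {set 'I_n} | (#|e| == r) && ~~ (e \subset ~: A)].
have cH : ('C(n, r) <= #|H| + 'C(n - q.-1, r))%N.
  have -> : (n - q.-1)%N = #|~: A| by have := cardsC A; rewrite card_ord cA => E; rewrite -[in LHS]E addKn.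
  rewrite -cards_draws -{1}(card_ord n) -card_draws -(cardsID [set e : {set 'I_n} | e \subset ~: A] [set e : {set 'I_n} | #|e| == r]).
  rewrite addnC leq_add //; apply/subset_leq_card/subsetP => e; rewrite !inE.
    by rewrite andbC.
  by rewrite andbC.
apply: leq_trans cH _; rewrite leq_add2r; apply: (bigop.bigmax_sup H) => //.
apply/asboolP; split; first by move=> e; rewrite inE => /andP[/eqP].
move=> U F [Ffor cU cF] [f [finj /subsetP sub]].
pose A' := [set u | f u \in A].
have cA' : (#|A'| <= q.-1)%N.
  rewrite -cA -(card_imset _ finj); apply/subset_leq_card/subsetP => _ /imsetP[u + ->].
  by rewrite inE.
have FA e : e \in F -> exists2 u, u \in A' & u \in e.
  move=> eF; have := sub _ (imset_f (fun e : {set U} => f @: e) eF).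
  rewrite inE => /andP[_ /subsetPn[_ /imsetP[u ue ->]]]; rewrite inE negbK => fu.
  by exists u; rewrite ?inE.
have : (#|F| <= r * q.-1)%N.
  apply: (@leq_trans (\sum_(u in A') #|[set e in F | u \in e]|)%N); last first.
    apply: (@leq_trans (\sum_(u in A') r)%N); first by apply: leq_sum => u _; apply: forest_degree.
    by rewrite sum_nat_const mulnC leq_mul2l cA' orbT.
  apply: (@leq_trans #|\bigcup_(u in A') [set e in F | u \in e]|).
    apply/subset_leq_card/subsetP => e eF; have [u uA ue] := FA e eF.
    by apply/bigcupP; exists u => //; rewrite inE eF.
  elim/big_rec2: _ => [|j m Y _ IH]; first by rewrite cards0.
  by apply: leq_trans (leq_card_setU _ _) _; rewrite leq_add2l.
rewrite cF -/k => h; have := leq_trans qk h.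
by rewrite leq_pmul2l // leqNgt prednK // leqnn.
Qed.

Lemma light_edges_of_dense (R : archiRealFieldType) (r : nat) (c1 delta : R) (V : finType)
    (H : {set {set V}}) (w : V -> R) (theta : R) :
  (0 < r)%N -> 0 < c1 -> c1 <= 1 / 2 -> 0 < theta ->
  (r.*2.+1 * r.*2.+2 <= #|V|)%N ->
  is_rgraph r.+1 H ->
  'C(#|V|, r.+1)%:R - 'C(#|V| - (Num.truncn (c1 * #|V|%:R / r.+1%:R)).+1, r.+1)%:R + delta
    <= #|H|%:R ->
  (forall v, 0 <= w v) -> \sum_v w v <= c1 / r.+1%:R * theta * #|V|%:R ->
  delta <= #|[set e in H | \sum_(x in e) w x < theta]|%:R.
Proof.
move=> r0 c10 c12 th0 nbig rH Hbig w0 wle.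
set n := #|V| in nbig Hbig wle; set q := (Num.truncn _).+1 in Hbig.
have x0 : 0 <= c1 * n%:R / r.+1%:R by rewrite divr_ge0 // mulr_ge0 // ltW.
have nq : (2 * q * r + q <= n)%N.
  have -> : (2 * q * r + q = q * r.*2.+1)%N by rewrite mulnS -muln2; lia.
  have h1 : (q.-1 * r.*2.+2 <= n)%N.
    rewrite -(@ler_nat R) natrM /q /= -ler_pdivlMr ?ltr0n //.
    apply: (@le_trans _ _ (c1 * n%:R / r.+1%:R)); first by rewrite truncn_le.
    have -> : r.*2.+2%:R = 2 * r.+1%:R :> R by rewrite -natrM; congr (_%:R); rewrite -muln2; lia.
    rewrite invfM mulrA; apply: ler_wpM2r; first by rewrite invr_ge0.
    by rewrite [X in _ <= X]mulrC; apply: ler_wpM2r => //; rewrite -div1r.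
  move: h1 nbig; rewrite /q /=; move: (Num.truncn _) => t; clear; rewrite -muln2; nia.
pose v x := w x / theta.
have v0 x : 0 <= v x by rewrite divr_ge0 // ltW.
have vq : \sum_x v x < q%:R.
  rewrite -mulr_suml ltr_pdivrMr //; apply: le_lt_trans wle _.
  have -> : c1 / r.+1%:R * theta * n%:R = (c1 * n%:R / r.+1%:R) * theta by ring.
  by rewrite ltr_pM2r // truncnS_gt.
have := card_light_ge r0 v0 vq nq; rewrite -/n.
set L := [set e : {set V} | _] => hL.
have LE : L :&: H \subset [set e in H | \sum_(x in e) w x < theta].
  apply/subsetP => e; rewrite !inE => /andP[/andP[_ h] ->] /=.
  by move: h; rewrite -mulr_suml ltr_pdivrMr // mul1r.
have LU : (#|L :|: H| <= 'C(n, r.+1))%N.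
  rewrite -card_draws; apply/subset_leq_card/subsetP => e; rewrite !inE => /orP[/andP[]//|/rH ->].
  by rewrite eqxx.
have h2 : (#|L| + #|H| <= 'C(n, r.+1) + #|[set e in H | (\sum_(x in e) w x < theta)%R]|)%N.
  by rewrite -cardsUI leq_add // subset_leq_card.
move: hL h2 Hbig; rewrite -!(@ler_nat R) !natrD; set x1 := #|L|%:R; set x2 := #|H|%:R.
set x3 := #|_|%:R; set x4 := _%:R; set x5 := _%:R; clear; lra.
Qed.

Lemma turan_upper (R : archiRealFieldType) (r : nat) (c eps : R) :
  (0 < r)%N -> 0 < c -> c < 1 / 2 -> 0 < eps ->
  exists n0 : nat, forall n, (n0 <= n)%N ->
  (turan_number r.+1 n (tight_linear_forests r.+1 n (Num.truncn (c * n%:R))))%:R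
    <= 'C(n, r.+1)%:R - 'C(n - Num.truncn (c * n%:R / r.+1%:R), r.+1)%:R
       + eps * (n ^ r.+1)%:R.
Proof.
move=> r0 c0 c12 eps0.
pose m := Num.min ((1 / 2 - c) / 2) (eps / 4).
have m0 : 0 < m by rewrite lt_min !divr_gt0 // subr_gt0.
have m1 : m <= (1 / 2 - c) / 2 by rewrite ge_min lexx.
have m2 : m <= eps / 4 by rewrite ge_min lexx orbT.
pose c1 := c + m.
have cc1 : c < c1 by rewrite ltrDl.
have c112 : c1 <= 1 / 2 by rewrite /c1; move: m1 c12; clear; lra.
have c11 : c1 <= 1 by move: c112; clear; lra.
have c10 : 0 < c1 := lt_trans c0 cc1.
have e20 : 0 < eps / 2 by rewrite divr_gt0.
have [n1 packing] := @exists_tight_packing R r c c1 (eps / 2) c0 cc1 c11 e20.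
have [n2 hn2] := exists_nat_bound (8 / eps).
exists (maxn n1 (maxn n2 (r.*2.+1 * r.*2.+2))) => n.
rewrite !geq_max => /and3P[nn1 nn2 nn3].
set k := Num.truncn (c * n%:R); set q0 := Num.truncn _.
pose q1 := (Num.truncn (c1 * n%:R / r.+1%:R)).+1.
have x0 : 0 <= c * n%:R / r.+1%:R by rewrite divr_ge0 // mulr_ge0 // ltW.
have x1 : 0 <= c1 * n%:R / r.+1%:R by rewrite divr_ge0 // mulr_ge0 // ltW.
have qq : (q1 - q0)%:R <= eps / 2 * n%:R.
  have h1 : q1%:R <= c1 * n%:R / r.+1%:R + 1 by rewrite /q1 -[X in X <= _]natr1 lerD2r truncn_le.
  have h2 : c * n%:R / r.+1%:R < q0%:R + 1 by have := truncnS_gt (c * n%:R / r.+1%:R); rewrite -[X in _ < X]natr1.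
  have h3 : c1 * n%:R / r.+1%:R = c * n%:R / r.+1%:R + m * n%:R / r.+1%:R by rewrite /c1 !mulrDl.
  have h4 : m * n%:R / r.+1%:R <= eps / 4 * n%:R.
    apply: (@le_trans _ _ (m * n%:R)); last exact: ler_wpM2r.
    by apply: ler_piMr; rewrite ?mulr_ge0 ?(ltW m0) // invf_le1 ?ler1n.
  have h5 : 2 <= eps / 4 * n%:R.
    have := hn2 _ nn2; rewrite ltr_pdivrMr // => h; move: h; set y := n%:R; clear; lra.
  have [q10|q10] := leqP q1 q0.
    by move/eqP: q10 => ->; rewrite mulr_ge0 // ltW.
  rewrite natrB ?(ltnW q10) //; move: h1 h2 h3 h4 h5; set y := n%:R; clear.
  set a := c1 * y / _; set b := c * y / _; set d := m * y / _; set e := q1%:R; set f := q0%:R.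
  by lra.
have binq : 'C(n - q0, r.+1)%:R <= 'C(n - q1, r.+1)%:R + eps / 2 * (n ^ r.+1)%:R.
  have := bin_sub_le n q0 q1 r; rewrite -(ler_nat R) natrD natrM => /le_trans; apply.
  by rewrite lerD2l expnS natrM mulrA ler_wpM2r.
have binn : 'C(n - q0, r.+1)%:R <= 'C(n, r.+1)%:R :> R by rewrite ler_nat leq_bin2l // leq_subr.
have N0 : 0 <= (n ^ r.+1)%:R :> R by [].
rewrite /turan_number.
apply: (big_ind (fun t : nat => t%:R <= 'C(n, r.+1)%:R - 'C(n - q0, r.+1)%:R + eps * (n ^ r.+1)%:R)).
- by rewrite addr_ge0 // ?subr_ge0 // mulr_ge0 // ltW.
- by move=> t u ht hu; rewrite /maxn; case: ifP.
move=> H /asboolP[rH Hfree]; rewrite leNgt; apply/negP => Hbig.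
have [|||ss [pss hss]] := packing 'I_n H; rewrite ?card_ord //.
  move=> w theta w0 th0 wle.
  apply: (@light_edges_of_dense R r c1 (eps / 2 * (n ^ r.+1)%:R) _ H w theta) => //; rewrite ?card_ord //.
  rewrite -/q1; move: Hbig binq; set x := _%:R; set y := 'C(n - q0, _)%:R; set u := 'C(n - q1, _)%:R.
  set v := #|H|%:R; move: (n ^ r.+1)%:R => z; clear; lra.
have kss : (k <= \sum_(s <- ss) ((size s).+1 - r.+1))%N.
  rewrite -(ler_nat R); apply: le_trans hss; rewrite card_ord truncn_le mulr_ge0 // ltW //.
have r1 : (1 < r.+1)%N by rewrite ltnS.
have [F [FF FH]] := packing_contains_forest r1 pss kss.
by apply: Hfree FH; move: FF; rewrite card_ord.
Qed.

From mathcomp Require Import all_classical all_reals all_analysis.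
Import Order.TTheory GRing.Theory Num.Theory.
Import numFieldNormedType.Exports.
Local Open Scope classical_set_scope.
Local Open Scope ring_scope.

Theorem theorem4p2 (R : realType) (r : nat) (c : R) :
  (3 <= r)%N -> 0 < c -> c < 1 / 2 ->
  (fun n : nat =>
     (turan_number r n (tight_linear_forests r n (Num.truncn (c * n%:R))))%:R : R)
  = (fun n : nat =>
       'C(n, r)%:R - 'C(n - Num.truncn (c * n%:R / r%:R), r)%:R : R)
    +o_\oo (fun n : nat => n%:R ^+ r : R).
Proof.
case: r => // r r2 c0 c12; apply/eqaddoP => eps eps0.
have r0 : (0 < r)%N by move: r2; rewrite ltnS => /ltnW.
have c1 : c <= 1 by rewrite (le_trans (ltW c12)) // ler_pdivrMr // mul1r ler1n.
have [n1 upper] := @turan_upper R r c eps r0 c0 c12 eps0.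
have [n2 hn2] := exists_nat_bound (eps^-1).
exists (maxn n1 n2) => // n /=; rewrite geq_max => /andP[nn1 nn2].
have {}upper := upper n nn1.
have := @turan_lower R r.+1 c n isT c0 c1.
set T := turan_number _ _ _ in upper *; set q := Num.truncn _ in upper *.
move=> lower; rewrite [X in _ <= _ * X]ger0_norm ?exprn_ge0 // -natrX ler_norml.
rewrite [X in _ <= X <= _](_ : _ = T%:R - ('C(n, r.+1)%:R - 'C(n - q, r.+1)%:R)) //.
apply/andP; split; last by rewrite lerBlDr addrC.
have := bin_sub_le n q.-1 q r; rewrite -(ler_nat R) natrD => bin.
move: lower; rewrite -(ler_nat R) natrD => lower.
have small : ((q - q.-1) * n ^ r)%:R <= eps * (n ^ r.+1)%:R.
  apply: (@le_trans _ _ (n ^ r)%:R).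
    by rewrite ler_nat -[X in (_ <= X)%N]mul1n leq_mul2r; case: (q) => [|q']; rewrite ?subSnn orbT.
  rewrite expnS natrM mulrA -[X in X <= _]mul1r; apply: ler_wpM2r => //.
  by have := hn2 _ nn2; rewrite -(ltr_pM2l eps0) mulfV ?gt_eqF // => /ltW.
move: lower bin small; set x := _%:R; set y := _%:R; set u := _%:R; set s := _%:R.
set N := eps * _; set t := _%:R; clear; lra.
Qed.
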